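(* Given a weighted pushdown game $\mathcal{G}$, the following problems are undecidable: (1) whether player 1 has a winning strategy (respectively a finite-memory winning strategy) for the objective $\Phi\bowtie 0$, where $\Phi\in\{\mathrm{LimSupAvg},\mathrm{LimInfAvg}\}$ and $\bowtie\in\{\geq,>\}$; (2) whether player 1 has a winning strategy (respectively a finite-memory winning strategy) for the objective $\Phi\bowtie 0$ together with stack boundedness, for the same $\Phi$ and $\bowtie$.
   Context: A weighted pushdown system (WPS) is $\mathcal{A}=\langle Q,\Gamma,q_0,E,w\rangle$ with finite states $Q$, finite stack alphabet $\Gamma\ni\bot$ ($\bot$ never pushed or popped), edges $E\subseteq(Q\times\Gamma)\times(Q\times\mathrm{Com}(\Gamma))$ with $\mathrm{Com}(\Gamma)=\{\mathit{skip},\mathit{pop}\}\cup\{\mathit{push}(z)\}$, weights $w:E\to\mathbb{Z}$; configurations $(\alpha,q)$ with $\alpha\in\Gamma^+$; successor of $(\alpha,q)$ via an edge $(q,\mathrm{Top}(\alpha),q',\mathit{com})$ is $(\mathit{com}(\alpha),q')$. A weighted pushdown game (WPG) is a WPS together with a partition $(Q_1,Q_2)$ of $Q$; it defines an infinite game graph on configurations, where configurations with state in $Q_i$ belong to player $i$, starting at $(\bot,q_0)$; in each round the owner of the current configuration chooses a successor configuration, producing an infinite play. A strategy for player 1 maps each finite history (sequence of configurations) ending in a player-1 configuration to a successor configuration; it is finite-memory if implementable by a finite-state transducer. A play is consistent with a strategy if all player-1 moves follow it. A player-1 strategy is winning for an objective if every consistent play (against every player-2 strategy) satisfies it. For an infinite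 play $\pi$, $\mathrm{LimSupAvg}(\pi)=\limsup_i w(\pi[0,i])/i$, $\mathrm{LimInfAvg}(\pi)=\liminf_i w(\pi[0,i])/i$; the objective $\Phi\bowtie 0$ is the set of plays with $\Phi(\pi)\bowtie 0$. Stack boundedness requires that the stack heights along the play be bounded. *)

(* Defs.v *)
From Stdlib Require Import List ZArith Reals Lia.
From Stdlib Require FinFun.
Import ListNotations.

(* 1. A Turing-complete model of computation: mu-recursive functions   *)
(*    (variadic, untyped arities; evaluation is a partial relation).   *)

Inductive rec : Type :=
| RZero : rec
| RSucc : rec
| RProj : nat -> rec
| RComp : rec -> list rec -> rec
| RPrim : rec -> rec -> rec
| RMu   : rec -> rec.

Inductive eval : rec -> list nat -> nat -> Prop :=
| eZero v : eval RZero v 0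
| eSucc x v : eval RSucc (x :: v) (S x)
| eProj i v : eval (RProj i) v (nth i v 0)
| eComp f gs v ys y : evals gs v ys -> eval f ys y -> eval (RComp f gs) v y
| ePrim0 f g v y : eval f v y -> eval (RPrim f g) (0 :: v) y
| ePrimS f g n v r y :
    eval (RPrim f g) (n :: v) r -> eval g (n :: r :: v) y ->
    eval (RPrim f g) (S n :: v) y
| eMu f v n :
    eval f (n :: v) 0 ->
    (forall m, m < n -> exists k, eval f (m :: v) (S k)) ->
    eval (RMu f) v n
with evals : list rec -> list nat -> list nat -> Prop :=
| esNil v : evals [] v []
| esCons g gs v y ys : eval g v y -> evals gs v ys -> evals (g :: gs) v (y :: ys).

Definition decidable_set (A : nat -> Prop) : Prop :=
  exists p : rec, forall n,
    (A n -> eval p [n] 1) /\ (~ A n -> eval p [n] 0).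

Definition undecidable_set (A : nat -> Prop) : Prop := ~ decidable_set A.

(*    States Q = {0,..,nQ-1}, stack alphabet Gamma = {0,..,nG-1},      *)

Definition bot : nat := 0.

Inductive com : Type := Skip | Pop | Push (z : nat).

Record edge : Type := mkEdge {
  e_src : nat;
  e_top : nat;
  e_dst : nat;
  e_com : com;
  e_w   : Z
}.

Record wpg : Type := mkWPG {
  nQ     : nat;
  nG     : nat;
  q0     : nat;
  edges  : list edge;
  player1 : list bool
}.

Definition in_Q1 (G : wpg) (q : nat) : Prop := nth q (player1 G) false = true.

Definition edge_key (e : edge) : nat * nat * nat * com :=
  (e_src e, e_top e, e_dst e, e_com e).

Definition valid_wpg (G : wpg) : Prop :=
  q0 G < nQ G /\ 0 < nG G /\
  length (player1 G) = nQ G /\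
  (* E is a set, w a function on it *)
  NoDup (map edge_key (edges G)) /\
  (forall e, In e (edges G) ->
     e_src e < nQ G /\ e_top e < nG G /\ e_dst e < nQ G /\
     match e_com e with
     | Skip => True
     | Pop => e_top e <> bot
     | Push z => 0 < z /\ z < nG G
     end) /\
  (forall q g, q < nQ G -> g < nG G ->
     exists e, In e (edges G) /\ e_src e = q /\ e_top e = g).

(* Configurations (alpha, q); the stack alpha is a list with its top first,
   so that the bottom symbol is the last element. *)
Definition config : Type := (list nat * nat)%type.

Definition Top (alpha : list nat) : nat := hd bot alpha.

Definition apply_com (c : com) (alpha : list nat) : list nat :=
  match c with
  | Skip => alpha
  | Pop => tl alpha
  | Push z => z :: alpha
  end.

Definition init_config (G : wpg) : config := ([bot], q0 G).

Definition enabled (G : wpg) (c : config) (e : edge) : Prop :=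
  In e (edges G) /\ e_src e = snd c /\ e_top e = Top (fst c).

Definition step (c : config) (e : edge) : config :=
  (apply_com (e_com e) (fst c), e_dst e).

Definition run (c : config) (h : list edge) : config := fold_left step h c.

(* A play is represented by the sequence of edges taken. *)
Definition play : Type := nat -> edge.

Fixpoint conf (G : wpg) (rho : play) (n : nat) : config :=
  match n with
  | O => init_config G
  | S m => step (conf G rho m) (rho m)
  end.

Definition is_play (G : wpg) (rho : play) : Prop :=
  forall n, enabled G (conf G rho n) (rho n).

Definition prefix (rho : play) (n : nat) : list edge := map rho (seq 0 n).

Fixpoint legal_from (G : wpg) (c : config) (h : list edge) : Prop :=
  match h with
  | [] => True
  | e :: h' => enabled G c e /\ legal_from G (step c e) h'
  end.

(* Player-1 strategies: histories (given by the moves made so far, which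
   determine the sequence of configurations) to the next move. *)
Definition strategy : Type := list edge -> edge.

Definition legal_strategy (G : wpg) (s : strategy) : Prop :=
  forall h, legal_from G (init_config G) h ->
    in_Q1 G (snd (run (init_config G) h)) ->
    enabled G (run (init_config G) h) (s h).

Definition consistent (G : wpg) (s : strategy) (rho : play) : Prop :=
  forall n, in_Q1 G (snd (conf G rho n)) -> rho n = s (prefix rho n).

Definition finite_memory (G : wpg) (s : strategy) : Prop :=
  exists (M : Type) (_ : FinFun.Finite M) (m0 : M)
         (upd : M -> edge -> M) (nxt : M -> nat -> nat -> edge),
    forall h, s h =
      nxt (fold_left upd h m0)
          (snd (run (init_config G) h)) (Top (fst (run (init_config G) h))).

Fixpoint wsum (rho : play) (i : nat) : Z :=
  match i with
  | O => 0%Z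
  | S j => (wsum rho j + e_w (rho j))%Z
  end.

Definition avg (rho : play) (i : nat) : R := IZR (wsum rho i) / INR i.

Inductive avg_kind : Type := LimSupAvg | LimInfAvg.
Inductive cmp : Type := Ge | Gt.

Definition objective (phi : avg_kind) (c : cmp) (rho : play) : Prop :=
  match phi, c with
  | LimSupAvg, Ge =>
      forall eps, (0 < eps)%R -> forall N, exists i, (N <= i)%nat /\ (1 <= i)%nat /\
        (- eps < avg rho i)%R
  | LimSupAvg, Gt =>
      exists eps, (0 < eps)%R /\ forall N, exists i, (N <= i)%nat /\ (1 <= i)%nat /\
        (eps <= avg rho i)%R
  | LimInfAvg, Ge =>
      forall eps, (0 < eps)%R -> exists N, forall i, (N <= i)%nat -> (1 <= i)%nat ->
        (- eps < avg rho i)%R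
  | LimInfAvg, Gt =>
      exists eps, (0 < eps)%R /\ exists N, forall i, (N <= i)%nat -> (1 <= i)%nat ->
        (eps <= avg rho i)%R
  end.

Definition stack_bounded (G : wpg) (rho : play) : Prop :=
  exists B, forall n, length (fst (conf G rho n)) <= B.

Definition player1_wins (G : wpg) (phi : avg_kind) (c : cmp) (fm sb : bool) : Prop :=
  exists s : strategy,
    legal_strategy G s /\
    (if fm then finite_memory G s else True) /\
    forall rho, is_play G rho -> consistent G s rho ->
      objective phi c rho /\ (if sb then stack_bounded G rho else True).

(* 3. Encoding games as natural numbers (Cantor pairing).              *)

Definition pair (x y : nat) : nat := (x + y) * (x + y + 1) / 2 + y.

Fixpoint enc_list {A} (f : A -> nat) (l : list A) : nat :=
  match l with
  | [] => 0
  | x :: l' => S (pair (f x) (enc_list f l'))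
  end.

Definition enc_Z (z : Z) : nat :=
  if (0 <=? z)%Z then 2 * Z.to_nat z else 2 * Z.to_nat (- z) - 1.

Definition enc_com (c : com) : nat :=
  match c with Skip => 0 | Pop => 1 | Push z => 2 + z end.

Definition enc_edge (e : edge) : nat :=
  pair (e_src e) (pair (e_top e) (pair (e_dst e) (pair (enc_com (e_com e)) (enc_Z (e_w e))))).

Definition enc_bool (b : bool) : nat := if b then 1 else 0.

Definition enc_wpg (G : wpg) : nat :=
  pair (nQ G) (pair (nG G) (pair (q0 G)
    (pair (enc_list enc_edge (edges G)) (enc_list enc_bool (player1 G))))).

Definition win_problem (phi : avg_kind) (c : cmp) (fm sb : bool) : nat -> Prop :=
  fun n => exists G, enc_wpg G = n /\ valid_wpg G /\ player1_wins G phi c fm sb.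

(* Main.v *)
From Stdlib Require Import List ZArith Reals Lia Lra Bool FunctionalExtensionality.
From Stdlib Require FinFun Fin.
Require Import Defs.
Import ListNotations.

(** The game of a counter machine plays rounds.  In a round the increments and
    decrements performed by the machine are pushed on the stack; at every zero
    test player 1 claims the outcome, and player 2 accepts the claim or
    challenges it.  A challenge empties the stack with weights that add up to
    [1 - 2 v] or [2 v - 1], [v] being the value of the tested register, so that
    it earns player 1 at least [1] if the claim is true and at most [-1] if it
    is false.  At a halt, the output register is challenged as if it were
    claimed to be zero.  For a machine that halts, rounds have bounded length,
    hence player 1 can force a positive mean payoff, with finite memory and
    bounded stack, if the output is zero, and player 2 can force a negative one
    otherwise.  This settles all the objectives at once.

    The initial register contents occur only as weights of the edges that leave
    the empty stack during a challenge.  Therefore the code of the game in which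
    a machine runs on the remaining data of its own game is a simple recursive
    function of these data.  Composing this function with an alleged decision
    procedure yields a total machine which halts with output zero on its own
    data iff player 1 does not win the very game that simulates this run. *)

(** * Register programs *)

Definition store : Type := nat -> nat.

Definition upd (s : store) (r v : nat) : store :=
  fun r' => if r' =? r then v else s r'.

Inductive cmd : Type :=
| CSkip : cmd
| CInc : nat -> cmd
| CDec : nat -> cmd
| CSeq : cmd -> cmd -> cmd
| CWhile : nat -> cmd -> cmd.

(** Decrementing zero has no derivation, so a terminating execution never does it; the game can
    therefore record decrements without checking them. *)
Inductive exec : cmd -> store -> store -> Prop :=
| xSkip s : exec CSkip s s
| xInc r s : exec (CInc r) s (upd s r (S (s r)))
| xDec r s n : s r = S n -> exec (CDec r) s (upd s r n)
| xSeq c1 c2 s1 s2 s3 : exec c1 s1 s2 -> exec c2 s2 s3 -> exec (CSeq c1 c2) s1 s3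
| xWhile0 r c s : s r = 0 -> exec (CWhile r c) s s
| xWhileS r c s1 s2 s3 :
    s1 r <> 0 -> exec c s1 s2 -> exec (CWhile r c) s2 s3 ->
    exec (CWhile r c) s1 s3.

Lemma exec_eq c s s1 s2 : exec c s s1 -> s1 = s2 -> exec c s s2.
Proof. now intros H <-. Qed.

Ltac store_ext :=
  apply functional_extensionality; intros ?r; unfold upd;
  repeat (match goal with
          | |- context [?a =? ?b] => destruct (Nat.eqb_spec a b)
          end; subst; try lia); try (f_equal; lia); try congruence.

Ltac upd_simpl := unfold upd;
  repeat (match goal with
          | |- context [?a =? ?b] => destruct (Nat.eqb_spec a b)
          end; subst; try lia).

Definition clear (r : nat) : cmd := CWhile r (CDec r).

Lemma exec_clear r s : exec (clear r) s (upd s r 0).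
Proof.
  remember (s r) as n eqn:E. revert s E.
  induction n as [|n IH]; intros s E.
  - eapply exec_eq; [apply xWhile0; lia|store_ext].
  - eapply xWhileS; [lia|apply xDec, eq_sym, E|].
    eapply exec_eq; [apply IH; upd_simpl|store_ext].
Qed.

Definition move (a b : nat) : cmd := CWhile a (CSeq (CDec a) (CInc b)).

Lemma exec_move a b s : a <> b ->
  exec (move a b) s (upd (upd s b (s b + s a)) a 0).
Proof.
  intros ne. remember (s a) as n eqn:E. revert s E.
  induction n as [|n IH]; intros s E.
  - eapply exec_eq; [apply xWhile0; lia|store_ext].
  - eapply xWhileS; [lia|eapply xSeq; [apply xDec, eq_sym, E|apply xInc]|].
    eapply exec_eq; [apply IH; upd_simpl|store_ext].
Qed.

(** A register can be read only by draining it; [t] keeps the value so that [a] can be restored. *)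
Definition copy (a t b : nat) : cmd :=
  CSeq (CWhile a (CSeq (CDec a) (CSeq (CInc t) (CInc b)))) (move t a).

Lemma exec_copy a t b s : a <> b -> t <> a -> t <> b -> s t = 0 ->
  exec (copy a t b) s (upd s b (s b + s a)).
Proof.
  intros ab ta tb st.
  assert (L : forall n s, s a = n ->
    exec (CWhile a (CSeq (CDec a) (CSeq (CInc t) (CInc b)))) s
         (upd (upd (upd s b (s b + n)) t (s t + n)) a 0)).
  { induction n as [|n IH]; intros s' E.
    - eapply exec_eq; [apply xWhile0; lia|store_ext].
    - eapply xWhileS; [lia|eapply xSeq;
        [apply xDec, E|eapply xSeq; apply xInc]|].
      eapply exec_eq; [apply IH; upd_simpl|store_ext]. }
  eapply xSeq; [now apply L|].
  eapply exec_eq; [now apply exec_move|store_ext].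
Qed.

Fixpoint clears (o k : nat) : cmd :=
  match k with 0 => CSkip | S k => CSeq (clear o) (clears (S o) k) end.

Lemma exec_clears k : forall o s,
  exec (clears o k) s (fun r => if (o <=? r) && (r <? o + k) then 0 else s r).
Proof.
  induction k as [|k IH]; intros o s; simpl.
  - eapply exec_eq; [apply xSkip|].
    apply functional_extensionality; intros r.
    destruct (Nat.leb_spec o r), (Nat.ltb_spec r (o + 0)); simpl; trivial; lia.
  - eapply xSeq; [apply exec_clear|].
    eapply exec_eq; [apply IH|].
    apply functional_extensionality; intros r.
    destruct (Nat.leb_spec o r), (Nat.ltb_spec r (o + S k)),
      (Nat.leb_spec (S o) r), (Nat.ltb_spec r (S o + k)); simpl; trivial;
      upd_simpl; trivial; lia.
Qed.

(* [comp f args out fr] adds the value of [f] to register [out]; registers from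
   [fr] on are scratch space, zero before and after. *)
Fixpoint comp (f : rec) (args : list nat) (out fr : nat) {struct f} : cmd :=
  match f with
  | RZero => CSkip
  | RSucc => CSeq (copy (hd 0 args) fr out) (CInc out)
  | RProj i =>
      match nth_error args i with Some a => copy a fr out | None => CSkip end
  | RComp f gs =>
      let k := length gs in
      CSeq
        ((fix comps (gs : list rec) (o : nat) : cmd :=
            match gs with
            | [] => CSkip
            | g :: gs => CSeq (comp g args o (fr + k)) (comps gs (S o))
            end) gs fr)
        (CSeq (comp f (seq fr k) out (fr + k)) (clears fr k))
  | RPrim f g =>
      CSeq (comp f (tl args) fr (4 + fr))
      (CSeq (copy (hd 0 args) (4 + fr) (3 + fr))
      (CSeq (CWhile (3 + fr)
        (CSeq (CDec (3 + fr))
        (CSeq (comp g (S fr :: fr :: tl args) (2 + fr) (4 + fr))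
        (CSeq (clear fr) (CSeq (move (2 + fr) fr) (CInc (S fr)))))))
      (CSeq (move fr out) (clear (S fr)))))
  | RMu f =>
      CSeq (comp f (fr :: args) (S fr) (2 + fr))
      (CSeq (CWhile (S fr)
        (CSeq (clear (S fr))
        (CSeq (CInc fr) (comp f (fr :: args) (S fr) (2 + fr)))))
      (move fr out))
  end.

(** The fixpoint nested in [comp], named so that its correctness can be stated separately. *)
Fixpoint comps (gs : list rec) (args : list nat) (o fr : nat) : cmd :=
  match gs with
  | [] => CSkip
  | g :: gs => CSeq (comp g args o fr) (comps gs args (S o) fr)
  end.

Lemma comp_RComp f gs args out fr :
  comp (RComp f gs) args out fr =
  CSeq (comps gs args fr (fr + length gs))
    (CSeq (comp f (seq fr (length gs)) out (fr + length gs)) (clears fr (length gs))).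
Proof.
  simpl. f_equal. generalize (fr + length gs) as fr'. generalize fr as o.
  induction gs as [|g gs IH]; intros o fr'; simpl; [reflexivity|].
  f_equal. apply IH.
Qed.

(** The generated principle gives no hypothesis for the functions in the list of [RComp]. *)
Lemma rec_nested_ind (Q : rec -> Prop) :
  Q RZero -> Q RSucc -> (forall i, Q (RProj i)) ->
  (forall f gs, Q f -> Forall Q gs -> Q (RComp f gs)) ->
  (forall f g, Q f -> Q g -> Q (RPrim f g)) ->
  (forall f, Q f -> Q (RMu f)) -> forall f, Q f.
Proof.
  intros H0 H1 H2 H3 H4 H5. fix IH 1. intros [| |i|f gs|f g|f].
  - exact H0.
  - exact H1.
  - apply H2.
  - apply H3; [apply IH|]. induction gs; constructor; [apply IH|assumption].
  - apply H4; apply IH.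
  - apply H5, IH.
Qed.

Definition comp_correct (f : rec) : Prop :=
  forall v y args out fr s,
    eval f v y -> map s args = v ->
    (forall a, In a args -> a < fr) -> out < fr -> ~ In out args ->
    (forall r, fr <= r -> s r = 0) ->
    exec (comp f args out fr) s (upd s out (s out + y)).

Lemma map_store_ext (s s' : store) args :
  (forall a, In a args -> s' a = s a) -> map s' args = map s args.
Proof. intros H. now apply map_ext_in. Qed.

(** The default [0] of [nth] describes the registers past the results, which are still clear. *)
Lemma comps_correct gs : Forall comp_correct gs ->
  forall v ys args o fr s,
    evals gs v ys -> map s args = v ->
    (forall a, In a args -> a < o) -> o + length gs <= fr ->
    (forall r, o <= r -> s r = 0) ->
    exec (comps gs args o fr) s
      (fun r => if r <? o then s r else nth (r - o) ys 0).
Proof.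
  induction 1 as [|g gs Hg _ IH]; intros v ys args o fr s Hev Hm Ha Hfr Hz;
    inversion Hev; subst; simpl in *.
  - eapply exec_eq; [apply xSkip|].
    apply functional_extensionality; intros r.
    destruct (Nat.ltb_spec r o); trivial.
    rewrite Hz by lia. now destruct (r - o).
  - eapply xSeq.
    + eapply Hg; eauto; try lia.
      * intros a Hin. apply Ha in Hin. lia.
      * intros Hin. apply Ha in Hin. lia.
      * intros r Hr. apply Hz. lia.
    + eapply exec_eq.
      * eapply IH; [eassumption| | |lia|].
        -- apply map_store_ext. intros a Hin. apply Ha in Hin. upd_simpl; trivial.
        -- intros a Hin. apply Ha in Hin. lia.
        -- intros r Hr. upd_simpl; apply Hz; lia.
      * apply functional_extensionality; intros r.
        destruct (Nat.ltb_spec r (S o)), (Nat.ltb_spec r o); try lia; upd_simpl; trivial.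
        -- rewrite Nat.sub_diag, Hz by lia. reflexivity.
        -- replace (r - o) with (S (r - S o)) by lia. reflexivity.
Qed.

Lemma evals_length gs v ys : evals gs v ys -> length ys = length gs.
Proof.
  revert ys. induction gs as [|g gs IH]; intros ys H; inversion H; subst; simpl; auto.
Qed.

Lemma comp_correct_RComp f gs :
  comp_correct f -> Forall comp_correct gs -> comp_correct (RComp f gs).
Proof.
  intros Hf Hgs v y args out fr s Hev Hm Ha Ho Hno Hz.
  inversion Hev as [| | |? ? ? ys ? Hevs Hevf| | |]; subst.
  rewrite comp_RComp. pose proof (evals_length _ _ _ Hevs) as Hlen.
  eapply xSeq; [eapply comps_correct; eauto|].
  eapply xSeq.
  - eapply Hf; [exact Hevf| | |lia| |].
    + rewrite <- Hlen. clear - ys. apply nth_ext with (d := 0) (d' := 0).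
      { now rewrite length_map, length_seq. }
      intros i Hi. rewrite length_map, length_seq in Hi.
      set (F := fun r => if r <? fr then s r else nth (r - fr) ys 0).
      rewrite nth_indep with (d' := F 0) by now rewrite length_map, length_seq.
      rewrite map_nth, seq_nth by assumption. unfold F.
      destruct (Nat.ltb_spec (fr + i) fr); [lia|]. f_equal. lia.
    + intros a Hin. apply in_seq in Hin. lia.
    + intros Hin. apply in_seq in Hin. lia.
    + intros r Hr. destruct (Nat.ltb_spec r fr); [lia|]. apply nth_overflow. lia.
  - eapply exec_eq; [apply exec_clears|].
    apply functional_extensionality; intros r. unfold upd.
    destruct (Nat.leb_spec fr r), (Nat.ltb_spec r (fr + length gs)); simpl;
      repeat match goal with
      | |- context [?a =? ?b] => destruct (Nat.eqb_spec a b); subst; try lia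
      | |- context [?a <? ?b] => destruct (Nat.ltb_spec a b); subst; try lia
      end; rewrite ?Hz by lia; trivial.
    apply nth_overflow. lia.
Qed.

(** Register layout: [fr] is the accumulator, [1 + fr] the index of the iteration, [2 + fr] the
    fresh result of [g], [3 + fr] the number of iterations left. *)
Lemma comp_correct_RPrim f g :
  comp_correct f -> comp_correct g -> comp_correct (RPrim f g).
Proof.
  intros Hf Hg v y args out fr s Hev Hm Ha Ho Hno Hz.
  destruct args as [|a rest]; [simpl in Hm; subst; inversion Hev|].
  simpl in Hm. subst v. cbn [comp hd tl].
  set (body := CSeq (CDec (3 + fr)) _).
  pose (st j acc m := upd (upd (upd s fr acc) (S fr) j) (3 + fr) m).
  assert (Hrest : forall r, In r rest -> r < fr) by (intros; apply Ha; now right).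
  assert (Hafr : a < fr) by (apply Ha; now left).
  assert (Hst : forall j acc m r, r < fr -> st j acc m r = s r).
  { intros j acc m r Hr. unfold st. upd_simpl; trivial. }
  assert (Hbody : forall j acc acc' m, eval g (j :: acc :: map s rest) acc' ->
    exec body (st j acc (S m)) (st (S j) acc' m)).
  { intros j acc acc' m Hevg. unfold body.
    eapply xSeq; [apply xDec with (n := m); unfold st; upd_simpl|].
    eapply xSeq; [eapply Hg; [exact Hevg| | |lia| |]|].
    - simpl. f_equal; [unfold st; upd_simpl|]. f_equal; [unfold st; upd_simpl|].
      apply map_store_ext. intros r Hr. apply Hrest in Hr. unfold st; upd_simpl; trivial.
    - intros r [<-|[<-|Hr]]; try lia. apply Hrest in Hr. lia.
    - intros [E|[E|Hr]]; try lia. apply Hrest in Hr. lia.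
    - intros r Hr. unfold st. upd_simpl; apply Hz; lia.
    - eapply xSeq; [apply exec_clear|]. eapply xSeq; [apply exec_move; lia|].
      eapply exec_eq; [apply xInc|]. unfold st.
      pose proof (Hz (2 + fr) ltac:(lia)).
      store_ext. }
  (* The derivation of [eval] unfolds from the last iteration, while the loop runs from the first.
     Hence the continuation form: an execution of what follows [n] iterations extends to one from
     the start. *)
  assert (Hloop : forall n r, eval (RPrim f g) (n :: map s rest) r ->
    exists r0, eval f (map s rest) r0 /\
      forall m e, exec (CWhile (3 + fr) body) (st n r m) e ->
        exec (CWhile (3 + fr) body) (st 0 r0 (n + m)) e).
  { induction n as [|n IH]; intros r Hr; inversion Hr as [| | | | |? ? ? ? r1 ? H1 H2|]; subst.
    - exists r. split; auto.
    - destruct (IH _ H1) as (r0 & H0 & Hex). exists r0. split; trivial.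
      intros m e He. replace (S n + m) with (n + S m) by lia. apply Hex.
      eapply xWhileS; [unfold st; upd_simpl|apply Hbody; eassumption|exact He]. }
  destruct (Hloop _ _ Hev) as (r0 & H0 & Hex).
  eapply xSeq; [eapply Hf; [exact H0|reflexivity| |lia| |]|].
  - intros r Hr. apply Hrest in Hr. lia.
  - intros Hr. apply Hrest in Hr. lia.
  - intros r Hr. apply Hz. lia.
  - pose proof (Hz fr ltac:(lia)) as Z0. pose proof (Hz (S fr) ltac:(lia)) as Z1.
    pose proof (Hz (3 + fr) ltac:(lia)) as Z3.
    eapply xSeq; [apply exec_copy; try lia; upd_simpl; apply Hz; lia|].
    eapply xSeq with (s2 := st (s a) y 0).
    + match goal with |- exec _ ?x _ => replace x with (st 0 r0 (s a + 0)) end.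
      * apply Hex. apply xWhile0. unfold st. upd_simpl.
      * unfold st. store_ext.
    + eapply xSeq; [apply exec_move; lia|].
      eapply exec_eq; [apply exec_clear|]. unfold st.
      store_ext.
Qed.

Lemma comp_correct_RMu f : comp_correct f -> comp_correct (RMu f).
Proof.
  intros Hf v n args out fr s Hev Hm Ha Ho Hno Hz.
  inversion Hev as [| | | | | |? ? ? H0 Hlt]; subst. cbn [comp].
  pose (st j k := upd (upd s fr j) (S fr) k).
  assert (Hcall : forall j k, eval f (j :: map s args) k ->
    exec (comp f (fr :: args) (S fr) (2 + fr)) (st j 0) (st j k)).
  { intros j k Hk. eapply exec_eq; [eapply Hf; [exact Hk| | |lia| |]|].
    - simpl. f_equal; [unfold st; upd_simpl|].
      apply map_store_ext. intros r Hr. apply Ha in Hr. unfold st; upd_simpl; trivial.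
    - intros r [<-|Hr]; try lia. apply Ha in Hr. lia.
    - intros [E|Hr]; try lia. apply Ha in Hr. lia.
    - intros r Hr. unfold st. upd_simpl; apply Hz; lia.
    - unfold st. store_ext. }
  set (body := CSeq (clear (S fr)) _).
  (* Induction on the distance [d] to the result; the current value [k] vanishes exactly at distance
     zero, so the loop stops neither early nor late. *)
  assert (Hloop : forall d j k, j + d = n -> eval f (j :: map s args) k ->
    (d = 0 -> k = 0) -> (d <> 0 -> k <> 0) ->
    exec (CWhile (S fr) body) (st j k) (st n 0)).
  { induction d as [|d IH]; intros j k E Hk Hk0 Hk1.
    - rewrite Hk0 by trivial. replace j with n by lia.
      apply xWhile0. unfold st. upd_simpl.
    - specialize (Hk1 ltac:(lia)).
      assert (Hnext : exists k', eval f (S j :: map s args) k' /\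
        (d = 0 -> k' = 0) /\ (d <> 0 -> k' <> 0)).
      { destruct d as [|d].
        - exists 0. replace (S j) with n by lia. repeat split; auto; lia.
        - destruct (Hlt (S j) ltac:(lia)) as [k' Hk']. exists (S k').
          repeat split; auto; lia. }
      destruct Hnext as (k' & Hk' & Hd0 & Hd1).
      eapply xWhileS with (s2 := st (S j) k'); [unfold st; upd_simpl| |].
      + unfold body. eapply xSeq; [apply exec_clear|]. eapply xSeq; [apply xInc|].
        match goal with |- exec _ ?x _ => replace x with (st (S j) 0) end; [now apply Hcall|].
        unfold st. store_ext.
      + apply IH; auto; lia. }
  assert (Hst0 : s = st 0 0).
  { pose proof (Hz fr ltac:(lia)). pose proof (Hz (S fr) ltac:(lia)). unfold st. store_ext. }
  assert (Hfirst : exists k, eval f (0 :: map s args) k /\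
    (n = 0 -> k = 0) /\ (n <> 0 -> k <> 0)).
  { destruct n as [|n].
    - exists 0. repeat split; auto; lia.
    - destruct (Hlt 0 ltac:(lia)) as [k' Hk']. exists (S k'). repeat split; auto; lia. }
  destruct Hfirst as (k & Hk & Hk0 & Hk1).
  eapply xSeq with (s2 := st 0 k).
  { rewrite Hst0 at 1. now apply Hcall. }
  eapply xSeq; [now apply (Hloop n 0 k)|].
  eapply exec_eq; [apply exec_move; lia|]. clear Hst0. unfold st.
  pose proof (Hz fr ltac:(lia)). pose proof (Hz (S fr) ltac:(lia)). store_ext.
Qed.

Lemma compile_correct f : comp_correct f.
Proof.
  induction f using rec_nested_ind.
  - intros v y args out fr s Hev _ _ _ _ _. inversion Hev; subst. simpl.
    eapply exec_eq; [apply xSkip|store_ext].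
  - intros v y args out fr s Hev Hm Ha Ho Hno Hz. subst v.
    destruct args as [|a args]; simpl in *; inversion Hev; subst.
    assert (a < fr) by (apply Ha; now left).
    assert (a <> out) by (intros ->; apply Hno; now left).
    eapply xSeq; [apply exec_copy; try lia; apply Hz; lia|].
    eapply exec_eq; [apply xInc|store_ext].
  - intros v y args out fr s Hev Hm Ha Ho Hno Hz. inversion Hev; subst. simpl.
    destruct (nth_error args i) as [a|] eqn:E.
    + assert (In a args) by (eapply nth_error_In; eassumption).
      assert (a < fr) by now apply Ha.
      assert (a <> out) by now intros ->.
      eapply exec_eq; [apply exec_copy; try lia; apply Hz; lia|].
      rewrite (nth_error_nth (map s args) i 0 (x := s a)); trivial.
      now apply map_nth_error.
    + eapply exec_eq; [apply xSkip|].
      apply nth_error_None in E. rewrite nth_overflow by now rewrite length_map.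
      store_ext.
  - now apply comp_correct_RComp.
  - now apply comp_correct_RPrim.
  - now apply comp_correct_RMu.
Qed.

(** * Counter machines *)

Inductive instr : Type :=
| IInc : nat -> instr
| IDec : nat -> instr
| IJz : nat -> nat -> nat -> instr
| IFin : nat -> instr.

Definition fetch (P : list instr) (l : nat) : instr := nth l P (IFin 0).

Definition mconf : Type := (nat * store)%type.

Inductive mstep (P : list instr) : mconf -> mconf -> Prop :=
| mInc l s r : fetch P l = IInc r -> mstep P (l, s) (S l, upd s r (S (s r)))
| mDec l s r n : fetch P l = IDec r -> s r = S n -> mstep P (l, s) (S l, upd s r n)
| mJz l s r l1 l2 : fetch P l = IJz r l1 l2 ->
    mstep P (l, s) (if s r =? 0 then l1 else l2, s).

Inductive mreach (P : list instr) : mconf -> mconf -> Prop :=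
| mreach_refl c : mreach P c c
| mreach_step c c' c'' : mstep P c c' -> mreach P c' c'' -> mreach P c c''.

Lemma mreach_trans P c c' c'' : mreach P c c' -> mreach P c' c'' -> mreach P c c''.
Proof. induction 1; eauto using mreach_step. Qed.

Lemma mreach_trace P c c' : mreach P c c' ->
  exists N tr, tr 0 = c /\ tr N = c' /\
    forall i, i < N -> mstep P (tr i) (tr (S i)).
Proof.
  induction 1 as [c|c c1 c2 H _ (N & tr & H0 & HN & Htr)].
  - exists 0, (fun _ => c). repeat split; trivial. lia.
  - exists (S N), (fun i => match i with 0 => c | S i => tr i end).
    repeat split; trivial. intros [|i] Hi.
    + now rewrite H0.
    + apply Htr. lia.
Qed.

(** * Translation of structured programs into instruction lists *)

Fixpoint csize (c : cmd) : nat :=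
  match c with
  | CSkip => 0
  | CInc _ | CDec _ => 1
  | CSeq c1 c2 => csize c1 + csize c2
  | CWhile _ c => 2 + csize c
  end.

(** Jump targets are absolute, hence the address [l]. The closing [IJz r l l], with equal targets,
    is an unconditional jump back to the test. *)
Fixpoint code (c : cmd) (l : nat) : list instr :=
  match c with
  | CSkip => []
  | CInc r => [IInc r]
  | CDec r => [IDec r]
  | CSeq c1 c2 => code c1 l ++ code c2 (l + csize c1)
  | CWhile r c => IJz r (l + (2 + csize c)) (S l) :: code c (S l) ++ [IJz r l l]
  end.

Lemma code_length c : forall l, length (code c l) = csize c.
Proof.
  induction c; intros l; simpl; rewrite ?length_app, ?IHc, ?IHc1, ?IHc2; simpl; lia.
Qed.

Definition embedded (P : list instr) (l : nat) (Q : list instr) : Prop :=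
  forall j, j < length Q -> fetch P (l + j) = fetch Q j.

Lemma embedded_app_l P l Q1 Q2 : embedded P l (Q1 ++ Q2) -> embedded P l Q1.
Proof.
  intros H j Hj. rewrite H by (rewrite length_app; lia).
  unfold fetch. now apply app_nth1.
Qed.

Lemma embedded_app_r P l Q1 Q2 :
  embedded P l (Q1 ++ Q2) -> embedded P (l + length Q1) Q2.
Proof.
  intros H j Hj. rewrite <- Nat.add_assoc, H by (rewrite length_app; lia).
  unfold fetch. rewrite app_nth2 by lia. f_equal. lia.
Qed.

Lemma embedded_head P l a Q : embedded P l (a :: Q) -> fetch P l = a.
Proof. intros H. specialize (H 0). rewrite Nat.add_0_r in H. apply H. simpl. lia. Qed.

Lemma embedded_tail P l a Q : embedded P l (a :: Q) -> embedded P (S l) Q.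
Proof.
  intros H j Hj. specialize (H (S j)). rewrite Nat.add_succ_r in H. apply H.
  simpl. lia.
Qed.

Lemma code_correct P c s s' : exec c s s' ->
  forall l, embedded P l (code c l) -> mreach P (l, s) (l + csize c, s').
Proof.
  induction 1; intros l Hl; simpl in *.
  - rewrite Nat.add_0_r. constructor.
  - apply embedded_head in Hl. rewrite Nat.add_1_r.
    eapply mreach_step; [apply mInc, Hl|constructor].
  - apply embedded_head in Hl. rewrite Nat.add_1_r.
    eapply mreach_step; [econstructor; eassumption|constructor].
  - eapply mreach_trans.
    + apply IHexec1. eapply embedded_app_l. eassumption.
    + apply embedded_app_r in Hl. rewrite code_length in Hl.
      rewrite Nat.add_assoc. now apply IHexec2.
  - apply embedded_head in Hl. eapply mreach_step; [eapply mJz; eassumption|].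
    rewrite H. constructor.
  - pose proof (embedded_head _ _ _ _ Hl) as Hh. pose proof (embedded_tail _ _ _ _ Hl) as Ht.
    eapply mreach_step; [eapply mJz; eassumption|].
    destruct (Nat.eqb_spec (s1 r) 0); [contradiction|].
    eapply mreach_trans; [apply IHexec1; eapply embedded_app_l; eassumption|].
    apply embedded_app_r, embedded_head in Ht. rewrite code_length in Ht.
    eapply mreach_step; [eapply mJz; eassumption|].
    replace (if s2 r =? 0 then l else l) with l by now destruct (s2 r =? 0).
    now apply IHexec2.
Qed.

Definition program (f : rec) (k : nat) : list instr :=
  let c := comp f (seq 0 k) k (S k) in code c 0 ++ [IFin k].

Lemma program_correct f v y : eval f v y ->
  exists l s, mreach (program f (length v)) (0, fun r => nth r v 0) (l, s) /\
    fetch (program f (length v)) l = IFin (length v) /\ s (length v) = y.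
Proof.
  intros Hev. set (s0 := fun r => nth r v 0). set (k := length v).
  set (c := comp f (seq 0 k) k (S k)).
  exists (csize c), (upd s0 k (s0 k + y)).
  assert (H0 : s0 k = 0) by (apply nth_overflow; unfold k; lia).
  repeat split.
  - apply (code_correct _ c) with (l := 0).
    + apply compile_correct with (v := v); [exact Hev| | |lia| |].
      * unfold s0, k. clear. induction v as [|x v IH]; simpl; [reflexivity|].
        f_equal. rewrite <- seq_shift, map_map. exact IH.
      * intros a Ha. apply in_seq in Ha. lia.
      * intros Ha. apply in_seq in Ha. lia.
      * intros r Hr. apply nth_overflow. unfold k in Hr. lia.
    + intros j Hj. apply app_nth1, Hj.
  - unfold fetch, program. fold c.
    rewrite app_nth2; rewrite code_length; [|lia]. now rewrite Nat.sub_diag.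
  - unfold upd. rewrite Nat.eqb_refl, H0. reflexivity.
Qed.

(** * Injectivity of the encoding of games *)

(** Doubling removes the division, so that injectivity becomes polynomial arithmetic. *)
Lemma pair_tri x y : 2 * pair x y = (x + y) * (x + y + 1) + 2 * y.
Proof.
  unfold pair. rewrite Nat.mul_add_distr_l. f_equal.
  assert (E : exists k, (x + y) * (x + y + 1) = 2 * k).
  { induction (x + y) as [|n [k Hk]].
    - now exists 0.
    - exists (k + S n). nia. }
  destruct E as [k ->]. rewrite (Nat.mul_comm 2 k), Nat.div_mul; lia.
Qed.

Lemma pair_inj x y x' y' : pair x y = pair x' y' -> x = x' /\ y = y'.
Proof.
  intros H. pose proof (pair_tri x y). pose proof (pair_tri x' y').
  (* The diagonal is determined because the offset [y] never reaches the next triangular number. *)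
  assert (x + y = x' + y').
  { destruct (Nat.lt_total (x + y) (x' + y')) as [L|[E|L]]; trivial; exfalso; nia. }
  nia.
Qed.

Lemma enc_list_inj {T} (f : T -> nat) :
  (forall a b, f a = f b -> a = b) ->
  forall l l', enc_list f l = enc_list f l' -> l = l'.
Proof.
  intros Hf. induction l as [|a l IH]; intros [|b l'] H; simpl in H; try discriminate; trivial.
  injection H as H. apply pair_inj in H as [H1 H2]. f_equal; auto.
Qed.

Lemma enc_Z_inj a b : enc_Z a = enc_Z b -> a = b.
Proof. unfold enc_Z. destruct (Z.leb_spec 0 a), (Z.leb_spec 0 b); lia. Qed.

Lemma enc_com_inj a b : enc_com a = enc_com b -> a = b.
Proof. destruct a, b; simpl; intros H; try lia; trivial. f_equal. lia. Qed.

Lemma enc_edge_inj a b : enc_edge a = enc_edge b -> a = b.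
Proof.
  destruct a, b. unfold enc_edge; simpl. intros H.
  repeat (apply pair_inj in H as [? H]).
  f_equal; auto using enc_com_inj, enc_Z_inj.
Qed.

Lemma enc_bool_inj a b : enc_bool a = enc_bool b -> a = b.
Proof. now destruct a, b. Qed.

Lemma enc_wpg_inj G G' : enc_wpg G = enc_wpg G' -> G = G'.
Proof.
  destruct G, G'. unfold enc_wpg; simpl. intros H.
  repeat (apply pair_inj in H as [? H]).
  f_equal; eauto using enc_list_inj, enc_edge_inj, enc_bool_inj.
Qed.

(** * Recursive functions *)

Lemma eval_comp1 h f v x y : eval f v x -> eval h [x] y -> eval (RComp h [f]) v y.
Proof. intros Hf Hh. econstructor; [|exact Hh]. repeat constructor. exact Hf. Qed.

Lemma eval_comp2 h f g v x x' y :
  eval f v x -> eval g v x' -> eval h [x; x'] y -> eval (RComp h [f; g]) v y.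
Proof. intros Hf Hg Hh. econstructor; [|exact Hh]. repeat constructor; assumption. Qed.

Lemma eval_succ f v x : eval f v x -> eval (RComp RSucc [f]) v (S x).
Proof. intros H. eapply eval_comp1; [exact H|constructor]. Qed.

Fixpoint r_const (n : nat) : rec :=
  match n with 0 => RZero | S n => RComp RSucc [r_const n] end.

Lemma eval_const n v : eval (r_const n) v n.
Proof. induction n; simpl; [constructor|now apply eval_succ]. Qed.

Definition r_add : rec := RPrim (RProj 0) (RComp RSucc [RProj 1]).

Lemma eval_add x y : eval r_add [x; y] (x + y).
Proof.
  induction x as [|x IH].
  - apply ePrim0. exact (eProj 0 [y]).
  - eapply ePrimS; [exact IH|]. apply eval_succ. exact (eProj 1 _).
Qed.

Definition r_tri : rec := RPrim RZero (RComp RSucc [RComp r_add [RProj 0; RProj 1]]).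

Lemma eval_tri n : eval r_tri [n] (n * (n + 1) / 2).
Proof.
  induction n as [|n IH].
  - apply ePrim0. constructor.
  - eapply ePrimS; [exact IH|].
    replace (S n * (S n + 1) / 2) with (S (n + n * (n + 1) / 2)).
    + apply eval_succ. eapply eval_comp2; [exact (eProj 0 _)|exact (eProj 1 _)|apply eval_add].
    + replace (S n * (S n + 1)) with (S n * 2 + n * (n + 1)) by lia.
      rewrite Nat.div_add_l by lia. reflexivity.
Qed.

Definition r_pred : rec := RPrim RZero (RProj 0).

Lemma eval_pred n : eval r_pred [n] (n - 1).
Proof.
  induction n as [|n IH].
  - apply ePrim0. constructor.
  - eapply ePrimS; [exact IH|]. replace (S n - 1) with n by lia. exact (eProj 0 _).
Qed.

Definition r_pair (f g : rec) : rec :=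
  RComp r_add [RComp r_tri [RComp r_add [f; g]]; g].

Lemma eval_pair f g v x y : eval f v x -> eval g v y -> eval (r_pair f g) v (pair x y).
Proof.
  intros Hf Hg. eapply eval_comp2; [|exact Hg|apply eval_add].
  eapply eval_comp1; [|apply eval_tri]. eapply eval_comp2; [exact Hf|exact Hg|apply eval_add].
Qed.

Definition r_mul4 (f : rec) : rec :=
  let g := RComp r_add [f; f] in RComp r_add [g; g].

Lemma eval_mul4 f v x : eval f v x -> eval (r_mul4 f) v (4 * x).
Proof.
  intros H. assert (H2 : eval (RComp r_add [f; f]) v (x + x))
    by (eapply eval_comp2; [exact H|exact H|apply eval_add]).
  replace (4 * x) with ((x + x) + (x + x)) by lia.
  eapply eval_comp2; [exact H2|exact H2|apply eval_add].
Qed.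

(** * The game of a counter machine *)

Inductive st : Type :=
| SA : nat -> st
| ST : bool -> nat -> st
| SC : bool -> nat -> st.

(** Residues modulo 5 separate the kinds, so the states with index below [M] fill exactly the
    numbers below [5 * M]. *)
Definition st_code (q : st) : nat :=
  match q with
  | SA l => 5 * l
  | ST b l => 5 * l + (if b then 1 else 2)
  | SC b r => 5 * r + (if b then 3 else 4)
  end.

Definition st_decode (q : nat) : st :=
  let i := q / 5 in
  match q mod 5 with
  | 0 => SA i
  | 1 => ST true i
  | 2 => ST false i
  | 3 => SC true i
  | _ => SC false i
  end.

Definition st_index (q : st) : nat :=
  match q with SA i | ST _ i | SC _ i => i end.

Lemma st_codeK q : st_decode (st_code q) = q.
Proof.
  assert (E : forall i j, j < 5 -> (5 * i + j) / 5 = i /\ (5 * i + j) mod 5 = j).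
  { intros i j Hj. split; symmetry.
    - now apply Nat.div_unique with j.
    - now apply Nat.mod_unique with i. }
  unfold st_decode. destruct q as [i|[] i|[] i]; simpl st_code;
    [replace (i + _) with (5 * i + 0) by lia| | | |];
    match goal with
    | |- context [(?a + ?j) / 5] => destruct (E i j ltac:(lia)) as [E1 E2]
    end; simpl Nat.mul in E1, E2; simpl Nat.mul; rewrite E1, E2; reflexivity.
Qed.

Lemma st_decodeK q : st_code (st_decode q) = q.
Proof.
  unfold st_decode. pose proof (Nat.div_mod_eq q 5). pose proof (Nat.mod_upper_bound q 5).
  destruct (q mod 5) as [|[|[|[|[|]]]]] eqn:E; unfold st_code; lia.
Qed.

Lemma st_code_inj q q' : st_code q = st_code q' -> q = q'.
Proof. intros H. rewrite <- (st_codeK q), H. apply st_codeK. Qed.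

Lemma st_code_bound q M : st_index q < M -> st_code q < 5 * M.
Proof. destruct q as [i|[] i|[] i]; simpl; lia. Qed.

Lemma st_decode_bound q M : q < 5 * M -> st_index (st_decode q) < M.
Proof.
  rewrite <- (st_decodeK q) at 1. destruct (st_decode q) as [i|[] i|[] i]; simpl; lia.
Qed.

Definition isym (r : nat) : nat := 1 + 2 * r.
Definition dsym (r : nat) : nat := 2 + 2 * r.

Definition delta (r g : nat) : Z :=
  if g =? isym r then 1%Z else if g =? dsym r then (-1)%Z else 0%Z.

(** The net change of register [r] recorded by the pushed symbols; the bottom symbol counts zero. *)
Fixpoint sval (r : nat) (al : list nat) : Z :=
  match al with [] => 0%Z | g :: al => (delta r g + sval r al)%Z end.

Definition sgn (b : bool) : Z := if b then (-2)%Z else 2%Z.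
Definition ent (b : bool) : Z := if b then 1%Z else (-1)%Z.

(* Player 1 claims at [SA l] that the tested register is zero ([ST true l]) or
   positive ([ST false l]).  Player 2 accepts, or challenges by moving to
   [SC b r]; emptying the stack there earns [1 - 2 v] for [b = true] and
   [2 v - 1] for [b = false], where [v] is the value of register [r]. *)
Definition out (P : list instr) (x : store) (q : st) (g : nat) : list (st * com * Z) :=
  match q with
  | SA l =>
      match fetch P l with
      | IInc r => [(SA (S l), Push (isym r), 0%Z)]
      | IDec r => [(SA (S l), Push (dsym r), 0%Z)]
      | IJz r l1 l2 => [(ST true l, Skip, 0%Z); (ST false l, Skip, 0%Z)]
      | IFin r => [(SC true r, Skip, 1%Z)]
      end
  | ST b l =>
      match fetch P l with
      | IJz r l1 l2 => [(SA (if b then l1 else l2), Skip, 0%Z); (SC b r, Skip, ent b)]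
      | _ => [(SA 0, Skip, 0%Z)]
      end
  | SC b r =>
      if g =? 0 then [(SA 0, Skip, (sgn b * Z.of_nat (x r))%Z)]
      else [(SC b r, Pop, (sgn b * delta r g)%Z)]
  end.

Definition edge_of (q g : nat) (t : st * com * Z) : edge :=
  match t with (d, c, w) => mkEdge q g (st_code d) c w end.

Definition iweight (i : instr) : nat :=
  match i with IInc r | IDec r | IFin r => r | IJz r l1 l2 => r + l1 + l2 end.

(** A crude strict bound on all labels and registers that occur; the [4] makes room for the label
    [length P] and for the input registers [0], [1], [2]. *)
Definition gsize (P : list instr) : nat := 4 + length P + list_sum (map iweight P).

(** The positions whose weights depend on the inputs: challenges of an input register that have
    reached the bottom of the stack. *)
Definition is_special (q g : nat) : bool :=
  (g =? 0) && match st_decode q with SC _ r => r <? 3 | _ => false end.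

Definition special_edges (x : store) : list edge :=
  flat_map (fun r => map (fun b =>
    mkEdge (st_code (SC b r)) 0 0 Skip (sgn b * Z.of_nat (x r))) [true; false]) [0; 1; 2].

Definition positions (P : list instr) : list (nat * nat) :=
  list_prod (seq 0 (5 * gsize P)) (seq 0 (1 + 2 * gsize P)).

(** Built from the zero store, hence determined by the program alone; [special_edges] supplies the
    omitted positions. *)
Definition plain_edges (P : list instr) : list edge :=
  flat_map (fun p => if is_special (fst p) (snd p) then [] else
    map (edge_of (fst p) (snd p)) (out P (fun _ => 0) (st_decode (fst p)) (snd p)))
    (positions P).

Definition is_A (q : nat) : bool :=
  match st_decode q with SA _ => true | _ => false end.

Definition owners (P : list instr) : list bool := map is_A (seq 0 (5 * gsize P)).

(* Only [special_edges] depends on the initial values [x] of the registers. *)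
Definition game (P : list instr) (x : store) : wpg :=
  {| nQ := 5 * gsize P; nG := 1 + 2 * gsize P; q0 := 0;
     edges := special_edges x ++ plain_edges P; player1 := owners P |}.

(** * Well-formedness of the game *)

Lemma list_sum_in n l : In n l -> n <= list_sum l.
Proof.
  induction l as [|m l IH]; [easy|]. intros [->|H]; simpl; [lia|]. apply IH in H. lia.
Qed.

Lemma iweight_fetch P l : 4 + iweight (fetch P l) <= gsize P.
Proof.
  unfold gsize, fetch. destruct (nth_in_or_default l P (IFin 0)) as [H| ->].
  - apply (in_map iweight), list_sum_in in H. lia.
  - simpl. lia.
Qed.

Lemma fetch_length P l : length P <= l -> fetch P l = IFin 0.
Proof. apply nth_overflow. Qed.

Lemma in_out_bound P x q g d c w : st_index q < gsize P ->
  In (d, c, w) (out P x q g) ->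
  st_index d < gsize P /\
  match c with Skip => True | Pop => g <> bot
  | Push z => 0 < z /\ z < 1 + 2 * gsize P end.
Proof.
  intros Hq H. unfold out in H.
  assert (Hsz : 4 + length P <= gsize P) by (unfold gsize; lia).
  pose proof (iweight_fetch P) as Hweight. set (M := gsize P) in *. clearbody M.
  destruct q as [l|b l|b r]; simpl in Hq.
  - specialize (Hweight l).
    assert (Hl : length P <= l -> fetch P l = IFin 0) by apply fetch_length.
    destruct (Nat.le_gt_cases (length P) l) as [L|L].
    + rewrite Hl in H by assumption. destruct H as [H|[]]. injection H as <- <- <-.
      simpl. split; trivial. lia.
    + destruct (fetch P l); simpl in *;
      repeat (destruct H as [H|H]; [injection H as <- <- <-|]); simpl;
      unfold isym, dsym; try easy; repeat split; lia.
  - specialize (Hweight l).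
    destruct (fetch P l); simpl in *;
      repeat (destruct H as [H|H]; [injection H as <- <- <-|]); simpl; try easy;
      destruct b; repeat split; lia.
  - destruct (Nat.eqb_spec g 0); simpl in H;
      destruct H as [H|[]]; injection H as <- <- <-; simpl; repeat split; trivial; lia.
Qed.

Lemma out_nonempty P x q g : exists t, In t (out P x q g).
Proof.
  unfold out. destruct q as [l|b l|b r].
  - destruct (fetch P l); eexists; left; reflexivity.
  - destruct (fetch P l); eexists; left; reflexivity.
  - destruct (g =? 0); eexists; left; reflexivity.
Qed.

Lemma out_plain P x x' q g : (forall r, 3 <= r -> x r = x' r) ->
  is_special q g = false -> out P x (st_decode q) g = out P x' (st_decode q) g.
Proof.
  intros Hx H. unfold is_special in H. unfold out.
  destruct (st_decode q) as [l|b l|b r]; trivial.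
  destruct (g =? 0); trivial. simpl in H. apply Nat.ltb_ge in H. now rewrite Hx.
Qed.

Lemma in_special e x : In e (special_edges x) <->
  is_special (e_src e) (e_top e) = true /\
  In e (map (edge_of (e_src e) (e_top e)) (out [] x (st_decode (e_src e)) (e_top e))).
Proof.
  split.
  - intros H. unfold special_edges in H. apply in_flat_map in H as (r & Hr & H).
    apply in_map_iff in H as (b & <- & _). cbn [e_src e_top].
    unfold is_special. rewrite st_codeK. simpl. split.
    + destruct Hr as [<-|[<-|[<-|[]]]]; reflexivity.
    + now left.
  - intros [H1 H2]. unfold is_special in H1. apply andb_true_iff in H1 as [H0 H1].
    apply Nat.eqb_eq in H0. rewrite H0 in *.
    pose proof (st_decodeK (e_src e)) as HK.
    destruct (st_decode (e_src e)) as [l|b l|b r] eqn:E; try discriminate.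
    apply Nat.ltb_lt in H1. simpl in H2. destruct H2 as [<-|[]].
    unfold special_edges. apply in_flat_map. exists r. split.
    + simpl. lia.
    + apply in_map_iff. exists b. split; [|destruct b; simpl; auto].
      cbn [e_src] in HK. now rewrite HK.
Qed.

Definition inputs_ok (x : store) : Prop := forall r, 3 <= r -> x r = 0.

(** Recovers a uniform description by [out] from the split edge list, which serves only the
    encoding; the arguments about plays rest on this. *)
Lemma in_edges P x e : inputs_ok x ->
  In e (edges (game P x)) <->
  e_src e < 5 * gsize P /\ e_top e < 1 + 2 * gsize P /\
  In e (map (edge_of (e_src e) (e_top e)) (out P x (st_decode (e_src e)) (e_top e))).
Proof.
  intros Hx. unfold game; cbn [edges]. rewrite in_app_iff.
  assert (Hs : is_special (e_src e) (e_top e) = true ->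
    e_src e < 5 * gsize P /\ e_top e < 1 + 2 * gsize P /\
    out P x (st_decode (e_src e)) (e_top e) = out [] x (st_decode (e_src e)) (e_top e)).
  { unfold is_special. intros H. apply andb_true_iff in H as [H0 H].
    apply Nat.eqb_eq in H0. rewrite H0.
    pose proof (st_decodeK (e_src e)) as HK.
    destruct (st_decode (e_src e)) as [l|b l|b r]; try discriminate.
    apply Nat.ltb_lt in H. split; [|split; [lia|reflexivity]].
    rewrite <- HK. apply st_code_bound. unfold gsize. simpl. lia. }
  destruct (is_special (e_src e) (e_top e)) eqn:E.
  - rewrite in_special, E. destruct (Hs eq_refl) as (H1 & H2 & ->). split.
    + intros [H|H]; [tauto|]. exfalso.
      unfold plain_edges in H. apply in_flat_map in H as ([q g] & _ & H). simpl in H.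
      destruct (is_special q g) eqn:E'; [easy|].
      apply in_map_iff in H as ([[d c] w] & <- & _). simpl in E. congruence.
    + tauto.
  - rewrite in_special, E. split.
    + intros [[H _]|H]; [discriminate|].
      unfold plain_edges in H. apply in_flat_map in H as ([q g] & Hp & H). simpl in H.
      unfold positions in Hp. apply in_prod_iff in Hp as [Hq Hg].
      apply in_seq in Hq. apply in_seq in Hg.
      destruct (is_special q g) eqn:E'; [easy|].
      apply in_map_iff in H as ([[d c] w] & <- & H). simpl in *.
      repeat split; try lia.
      apply in_map_iff. exists (d, c, w). split; trivial.
      rewrite (out_plain P x (fun _ => 0)); trivial.
    + intros (H1 & H2 & H3). right. unfold plain_edges. apply in_flat_map.
      exists (e_src e, e_top e). split.
      * apply in_prod_iff. split; apply in_seq; lia.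
      * cbn [fst snd]. rewrite E. now rewrite (out_plain P (fun _ => 0) x) by (trivial; intros; symmetry; auto).
Qed.

Lemma NoDup_map_flat_map {T U V} (k : U -> V) (f : T -> list U) l :
  NoDup l -> (forall a, NoDup (map k (f a))) ->
  (forall a b u v, In u (f a) -> In v (f b) -> k u = k v -> a = b) ->
  NoDup (map k (flat_map f l)).
Proof.
  intros Hl Hf Hk. induction Hl as [|a l Ha _ IH]; simpl; [constructor|].
  rewrite map_app. apply NoDup_app; trivial.
  intros w H1 H2. apply in_map_iff in H1 as (u & <- & Hu).
  apply in_map_iff in H2 as (v & E & Hv). apply in_flat_map in Hv as (b & Hb & Hv).
  apply Ha. now rewrite (Hk a b u v).
Qed.

Lemma NoDup_list_prod {T U} (l : list T) (l' : list U) :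
  NoDup l -> NoDup l' -> NoDup (list_prod l l').
Proof.
  intros Hl Hl'. induction Hl as [|a l Ha _ IH]; simpl; [constructor|].
  apply NoDup_app; trivial.
  - apply FinFun.Injective_map_NoDup; trivial. intros u v E. now injection E.
  - intros [u v] H1 H2. apply in_map_iff in H1 as (w & E & _).
    injection E as -> ->. apply in_prod_iff in H2. tauto.
Qed.

Lemma NoDup_out P x q g p :
  NoDup (map edge_key (map (edge_of q g) (out P x p g))).
Proof.
  assert (H1 : forall t : nat * nat * nat * com, NoDup [t]) by (repeat constructor; easy).
  assert (H2 : forall t u : nat * nat * nat * com, t <> u -> NoDup [t; u]).
  { intros t u H. constructor; [intros [E|[]]; congruence|apply H1]. }
  unfold out. destruct p as [l|b l|b r].
  - destruct (fetch P l); try apply H1. apply H2.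
    intros E. injection E as E. lia.
  - destruct (fetch P l); try apply H1. apply H2.
    intros E. injection E as E. apply (st_code_inj (SA _) (SC _ _)) in E. discriminate.
  - destruct (g =? 0); apply H1.
Qed.

Lemma game_valid P x : inputs_ok x -> valid_wpg (game P x).
Proof.
  intros Hx. assert (0 < gsize P) by (unfold gsize; lia).
  unfold valid_wpg. split; [simpl; lia|]. split; [simpl; lia|].
  split; [unfold game, owners; cbn [player1 nQ]; now rewrite length_map, length_seq|].
  split; [|split].
  - cbn [game edges]. rewrite map_app. apply NoDup_app.
    + simpl. repeat constructor; simpl; intuition discriminate.
    + apply NoDup_map_flat_map.
      * apply NoDup_list_prod; apply seq_NoDup.
      * intros [q g]. simpl. destruct (is_special q g); [constructor|apply NoDup_out].
      * intros [q g] [q' g'] u v. simpl.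
        destruct (is_special q g); [easy|]. destruct (is_special q' g'); [easy|].
        intros Hu Hv. apply in_map_iff in Hu as ([[? ?] ?] & <- & _).
        apply in_map_iff in Hv as ([[? ?] ?] & <- & _).
        unfold edge_key; simpl. intros E. now injection E as -> -> _ _.
    + intros k H1 H2. apply in_map_iff in H1 as (e1 & <- & H1).
      apply in_map_iff in H2 as (e2 & E & H2).
      apply in_special in H1 as [H1 _].
      unfold plain_edges in H2. apply in_flat_map in H2 as ([q g] & _ & H2). simpl in H2.
      destruct (is_special q g) eqn:E'; [easy|].
      apply in_map_iff in H2 as ([[d c] w] & <- & _). unfold edge_key in E; simpl in E.
      injection E as -> -> _ _. congruence.
  - intros e He. apply in_edges in He as (H1 & H2 & H3); trivial.
    apply in_map_iff in H3 as ([[d c] w] & <- & H3). simpl in *.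
    apply in_out_bound in H3 as [H3 H4]; [|now apply st_decode_bound].
    apply st_code_bound in H3. tauto.
  - intros q g Hq Hg. destruct (out_nonempty P x (st_decode q) g) as [[[d c] w] Ht].
    exists (edge_of q g (d, c, w)). split; [|easy].
    apply in_edges; trivial. cbn in Hq, Hg. repeat split; trivial. now apply in_map.
Qed.

Lemma enabled_game P x al q e : inputs_ok x ->
  enabled (game P x) (al, q) e ->
  exists d c w, In (d, c, w) (out P x (st_decode q) (Top al)) /\
    e = mkEdge q (Top al) (st_code d) c w.
Proof.
  intros Hx (H1 & H2 & H3). apply in_edges in H1 as (_ & _ & H1); trivial.
  simpl in H2, H3. rewrite H2, H3 in H1.
  apply in_map_iff in H1 as ([[d c] w] & E & H1). exists d, c, w. split; trivial. now symmetry.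
Qed.

Lemma game_enabled P x al q t : inputs_ok x ->
  q < 5 * gsize P -> Top al < 1 + 2 * gsize P ->
  In t (out P x (st_decode q) (Top al)) ->
  enabled (game P x) (al, q) (edge_of q (Top al) t).
Proof.
  intros Hx Hq Hg Ht. destruct t as [[d c] w]. split; [|easy].
  apply in_edges; trivial. simpl. repeat split; trivial.
  exact (in_map (edge_of q (Top al)) _ _ Ht).
Qed.

Lemma in_Q1_game P x q : in_Q1 (game P x) q <-> q < 5 * gsize P /\ is_A q = true.
Proof.
  unfold in_Q1, game, owners; cbn [player1].
  destruct (Nat.lt_ge_cases q (5 * gsize P)) as [H|H].
  - rewrite nth_indep with (d' := is_A 0) by now rewrite length_map, length_seq.
    rewrite map_nth, seq_nth by assumption. simpl. tauto.
  - rewrite nth_overflow by now rewrite length_map, length_seq. split; [easy|]. lia.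
Qed.

(** * Plays and histories *)

Lemma prefix_S rho n : prefix rho (S n) = prefix rho n ++ [rho n].
Proof. unfold prefix. now rewrite seq_S, map_app. Qed.

Lemma run_snoc c h e : run c (h ++ [e]) = step (run c h) e.
Proof. unfold run. now rewrite fold_left_app. Qed.

Lemma conf_run G rho n : conf G rho n = run (init_config G) (prefix rho n).
Proof. induction n as [|n IH]; [reflexivity|]. now rewrite prefix_S, run_snoc, <- IH. Qed.

Lemma legal_from_snoc G e h : forall c,
  legal_from G c (h ++ [e]) <-> legal_from G c h /\ enabled G (run c h) e.
Proof.
  induction h as [|e' h IH]; intros c; simpl; [tauto|]. rewrite IH. simpl. tauto.
Qed.

Lemma legal_bounds G h : valid_wpg G -> legal_from G (init_config G) h ->
  snd (run (init_config G) h) < nQ G /\ Forall (fun g => g < nG G) (fst (run (init_config G) h)).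
Proof.
  intros (V1 & V2 & _ & _ & V5 & _). induction h as [|e h IH] using rev_ind; intros H.
  - simpl. unfold bot. auto.
  - apply legal_from_snoc in H as [H (He & _)]. rewrite run_snoc.
    destruct (IH H) as [IH1 IH2]. apply V5 in He as (_ & _ & Hd & Hc).
    unfold step; simpl. split; trivial.
    destruct (e_com e); simpl; trivial.
    + now destruct IH2.
    + constructor; tauto.
Qed.

Lemma Top_bound G al : 0 < nG G -> Forall (fun g => g < nG G) al -> Top al < nG G.
Proof. intros H [|]; simpl; trivial. Qed.

(** * Growth of the payoff *)

(* The number of machine steps simulated in the current round. *)
Definition tick (t : nat) (e : edge) : nat :=
  match st_decode (e_src e) with SA _ => S t | ST _ _ => t | SC _ _ => 0 end.

Definition ticks (h : list edge) : nat := fold_left tick h 0.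

Lemma ticks_snoc h e : ticks (h ++ [e]) = tick (ticks h) e.
Proof. unfold ticks. now rewrite fold_left_app. Qed.

Lemma sval_bound r al : (- Z.of_nat (length al) <= sval r al <= Z.of_nat (length al))%Z.
Proof.
  induction al as [|g al IH]; [simpl; lia|].
  cbn [sval length]. unfold delta. destruct (g =? isym r), (g =? dsym r); lia.
Qed.

Lemma sval_snoc0 r be : sval r (be ++ [0]) = sval r be.
Proof. induction be as [|g be IH]; [reflexivity|]. simpl. now rewrite IH. Qed.

Lemma delta_isym r r' : delta r (isym r') = if r =? r' then 1%Z else 0%Z.
Proof.
  unfold delta, isym, dsym.
  destruct (Nat.eqb_spec r r'), (Nat.eqb_spec (1 + 2 * r') (1 + 2 * r)),
    (Nat.eqb_spec (1 + 2 * r') (2 + 2 * r)); trivial; lia.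
Qed.

Lemma delta_dsym r r' : delta r (dsym r') = if r =? r' then (-1)%Z else 0%Z.
Proof.
  unfold delta, isym, dsym.
  destruct (Nat.eqb_spec r r'), (Nat.eqb_spec (2 + 2 * r') (1 + 2 * r)),
    (Nat.eqb_spec (2 + 2 * r') (2 + 2 * r)); trivial; lia.
Qed.

Definition halting_trace (P : list instr) (x : store) (N : nat) (tr : nat -> mconf) (rf v : nat) : Prop :=
  tr 0 = (0, x) /\ (forall i, i < N -> mstep P (tr i) (tr (S i))) /\
  fetch P (fst (tr N)) = IFin rf /\ snd (tr N) rf = v.

(** The stack records the changes since the start of the round, when the registers contained [x].
    Its symbols are nonzero, so a challenge meets [0] only at the bottom. *)
Definition represents (x : store) (be : list nat) (s : store) : Prop :=
  Forall (fun g => g <> 0) be /\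
  forall r, (Z.of_nat (x r) + sval r be)%Z = Z.of_nat (s r).

(* [n] is the time, [W] the payoff so far and [t] the clock of the round.  A
   round that is bound to earn [sigma] lasts at most [3 N + 2] moves, so that
   [sigma * (3 N + 2) * W] outruns [n] up to the duration of a round. *)
Inductive inv (P : list instr) (x : store) (N : nat) (tr : nat -> mconf) (sigma : Z)
    (n : nat) : config -> Z -> nat -> Prop :=
| invA i l s be W :
    i <= N -> tr i = (l, s) -> represents x be s -> length be <= i ->
    (Z.of_nat n <= sigma * (Z.of_nat (3 * N + 2) * W) + 2 * Z.of_nat i)%Z ->
    inv P x N tr sigma n (be ++ [0], st_code (SA l)) W i
| invT i l s be W b r l1 l2 :
    i < N -> tr i = (l, s) -> represents x be s -> length be <= i ->
    fetch P l = IJz r l1 l2 -> (sigma = 1%Z -> b = (s r =? 0)) ->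
    (Z.of_nat n <= sigma * (Z.of_nat (3 * N + 2) * W) + 2 * Z.of_nat i + 1)%Z ->
    inv P x N tr sigma n (be ++ [0], st_code (ST b l)) W (S i)
| invC be W b r t :
    Forall (fun g => g <> 0) be -> length be <= N ->
    (Z.of_nat n + Z.of_nat (length be) + 1 <= sigma * (Z.of_nat (3 * N + 2) *
       (W + sgn b * (Z.of_nat (x r) + sval r be))))%Z ->
    inv P x N tr sigma n (be ++ [0], st_code (SC b r)) W t.

(** Entering a challenge settles its total gain [u]; a gain of at least [1] in the direction [sigma]
    pays for the [K] moves that a round can last. *)
Lemma enter_gain (sigma K W u : Z) : (0 <= K -> 1 <= sigma * u ->
  sigma * (K * W) + K <= sigma * (K * (W + u)))%Z.
Proof. intros HK Hu. nia. Qed.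

(** Both outcomes are treated together. For [sigma = 1] player 1 claims truthfully against arbitrary
    replies; for [sigma = -1] player 2 challenges exactly the false claims, whatever player 1
    claims. Either way the play follows the trace until a challenge that favours the side of
    [sigma]. *)
Lemma inv_step P x N tr rf v sigma n al q W t e :
  inputs_ok x -> halting_trace P x N tr rf v ->
  (sigma = 1 \/ sigma = -1)%Z -> (1 <= sigma * (1 - 2 * Z.of_nat v))%Z ->
  inv P x N tr sigma n (al, q) W t ->
  enabled (game P x) (al, q) e ->
  (forall l s r l1 l2, sigma = 1%Z -> q = st_code (SA l) -> t <= N -> tr t = (l, s) ->
     fetch P l = IJz r l1 l2 -> e_dst e = st_code (ST (s r =? 0) l)) ->
  (forall b l r l1 l2, sigma = (-1)%Z -> q = st_code (ST b l) ->
     fetch P l = IJz r l1 l2 ->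
     e_dst e = if Bool.eqb b (Z.of_nat (x r) + sval r al =? 0)%Z
               then st_code (SA (if b then l1 else l2)) else st_code (SC b r)) ->
  inv P x N tr sigma (S n) (step (al, q) e) (W + e_w e) (tick t e).
Proof.
  intros Hx (H0 & Hstep & Hfin & Hv) Hsig Hwin Hinv Hen HA HT.
  apply enabled_game in Hen as (d & c & w & Hin & ->); trivial.
  unfold step, tick. cbn [fst snd e_src e_dst e_com e_w].
  cbn [e_dst] in HA, HT. subst v.
  remember (al, q) as aq eqn:Eq.
  pose proof (f_equal fst Eq) as Ea. pose proof (f_equal snd Eq) as Eb. clear Eq.
  cbn [fst snd] in Ea, Eb. subst al q.
  destruct Hinv as [t l s be W Hi Htr [Hnz Hrep] Hlen Hn
                   |i l s be W b r l1 l2 Hi Htr [Hnz Hrep] Hlen Hf Hb Hn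
                   |be W b r t Hnz Hlen Hn]; cbn [fst snd] in *;
    rewrite st_codeK in *; cbn [out] in Hin.
  - destruct (Nat.eq_dec t N) as [->|Hne].
    (* At the halt, this edge and the emptying of the stack earn [1 - 2 v] for the output [v]. At
       most [2 N] moves of simulation, this one, [N] pops and the bottom edge make [3 N + 2]. *)
    + rewrite Htr in Hfin. cbn [fst] in Hfin. rewrite Hfin in Hin.
      destruct Hin as [Hin|[]]. injection Hin as <- <- <-. cbn [apply_com].
      apply invC; trivial.
      rewrite Htr in Hwin. cbn [snd] in Hwin. rewrite Hrep, <- Z.add_assoc.
      pose proof (enter_gain sigma (Z.of_nat (3 * N + 2)) W
        (1 + sgn true * Z.of_nat (s rf))) as G.
      assert (1 <= sigma * (1 + sgn true * Z.of_nat (s rf)))%Z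
        by (cbn [sgn]; destruct Hsig; subst; lia).
      lia.
    + assert (Hlt : t < N) by lia. pose proof (Hstep t Hlt) as Hs. rewrite Htr in Hs.
      inversion Hs as [l' s' r' Hf E1 E2|l' s' r' m Hf Hm E1 E2|l' s' r' l1 l2 Hf E1 E2]; subst;
        rewrite Hf in Hin.
      * destruct Hin as [Hin|[]]. injection Hin as <- <- <-. cbn [apply_com].
        apply (invA P x N tr sigma (S n) (S t) (S l) (upd s r' (S (s r'))) (isym r' :: be)); try lia.
        -- now symmetry.
        -- split.
           ++ constructor; trivial. unfold isym. lia.
           ++ intros r. cbn [sval]. rewrite delta_isym. specialize (Hrep r).
              unfold upd. destruct (Nat.eqb_spec r r'); subst; lia.
        -- simpl. lia.
      * destruct Hin as [Hin|[]]. injection Hin as <- <- <-. cbn [apply_com].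
        apply (invA P x N tr sigma (S n) (S t) (S l) (upd s r' m) (dsym r' :: be)); try lia.
        -- now symmetry.
        -- split.
           ++ constructor; trivial. unfold dsym. lia.
           ++ intros r. cbn [sval]. rewrite delta_dsym. specialize (Hrep r).
              unfold upd. destruct (Nat.eqb_spec r r'); subst; lia.
        -- simpl. lia.
      * assert (Hd : exists b, d = ST b l /\ c = Skip /\ w = 0%Z).
        { destruct Hin as [Hin|[Hin|[]]]; injection Hin as <- <- <-; eauto. }
        destruct Hd as (b & -> & -> & ->). cbn [apply_com].
        eapply invT; try eassumption; try lia.
        -- now split.
        -- intros Hs1. specialize (HA l s r' l1 l2 Hs1 eq_refl Hi Htr Hf).
           apply st_code_inj in HA. now injection HA.
  - rewrite Hf in Hin. pose proof (Hstep i Hi) as Hs. rewrite Htr in Hs.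
    inversion Hs as [l' s' r' Hf' E1 E2|l' s' r' m Hf' Hm E1 E2|l' s' r' l1' l2' Hf' E1 E2];
      subst; rewrite Hf in Hf'; try discriminate. injection Hf' as -> -> ->.
    destruct Hin as [Hin|[Hin|[]]]; injection Hin as <- <- <-; cbn [apply_com].
    (* An accepted claim is true, because player 1 is truthful or because player 2 challenges false
       claims; so the play stays on the trace. *)
    + assert (Hbt : b = (s r' =? 0)).
      { destruct Hsig as [Hs1|Hs1]; [now apply Hb|].
        specialize (HT b l r' l1' l2' Hs1 eq_refl Hf). rewrite sval_snoc0, Hrep in HT.
        destruct (Bool.eqb b (Z.of_nat (s r') =? 0)%Z) eqn:E.
        - apply Bool.eqb_prop in E. rewrite E.
          destruct (Nat.eqb_spec (s r') 0), (Z.eqb_spec (Z.of_nat (s r')) 0); trivial; lia.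
        - apply st_code_inj in HT. discriminate. }
      rewrite Hbt. eapply invA; try lia.
      * exact (eq_sym E2).
      * now split.
    (* A challenged claim is true if [sigma = 1] and false if [sigma = -1]. *)
    + assert (Hu : (1 <= sigma * (ent b + sgn b * Z.of_nat (s r')))%Z).
      { destruct Hsig as [Hs1|Hs1].
        - rewrite Hb, Hs1 by trivial. destruct (Nat.eqb_spec (s r') 0); cbn [ent sgn]; lia.
        - specialize (HT b l r' l1' l2' Hs1 eq_refl Hf). rewrite sval_snoc0, Hrep in HT.
          destruct (Bool.eqb b (Z.of_nat (s r') =? 0)%Z) eqn:E.
          + apply st_code_inj in HT. discriminate.
          + rewrite Hs1.
            destruct b, (Z.eqb_spec (Z.of_nat (s r')) 0); try discriminate; cbn [ent sgn]; lia. }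
      apply invC; trivial; [lia|].
      rewrite Hrep, <- Z.add_assoc.
      pose proof (enter_gain sigma (Z.of_nat (3 * N + 2)) W _ ltac:(lia) Hu). lia.
  - destruct be as [|g be].
    (* The bottom edge pays the share of the initial value, and a new round starts with clock
       [0]. *)
    + destruct Hin as [Hin|[]]. injection Hin as <- <- <-. cbn [apply_com app].
      apply (invA P x N tr sigma (S n) 0 0 x []); try lia; trivial.
      * split; [constructor|]. intros r'. simpl. lia.
      * simpl in Hn. rewrite Z.add_0_r in Hn. lia.
    + inversion Hnz as [|? ? Hg Hnz']; subst. cbn [app Top hd] in Hin.
      destruct (Nat.eqb_spec g 0); [contradiction|].
      destruct Hin as [Hin|[]]. injection Hin as <- <- <-. cbn [apply_com app tl].
      apply invC; trivial; [simpl in Hlen; lia|].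
      cbn [sval length] in Hn.
      replace (W + sgn b * delta r g + sgn b * (Z.of_nat (x r) + sval r be))%Z
        with (W + sgn b * (Z.of_nat (x r) + (delta r g + sval r be)))%Z by ring.
      lia.
Qed.

(** The constant covers an unfinished round: at most [2 (X + N)] of payoff outstanding in a
    challenge, or [2 N + 1] moves of simulation not yet paid for. *)
Lemma inv_bound P x N tr sigma n c W t X :
  (sigma = 1 \/ sigma = -1)%Z -> (forall r, x r <= X) ->
  inv P x N tr sigma n c W t ->
  (Z.of_nat n <= sigma * (Z.of_nat (3 * N + 2) * W) +
    Z.of_nat (2 * (3 * N + 2) * (X + N) + 2 * N + 1))%Z /\
  length (fst c) <= S N.
Proof.
  intros Hsig HX [i l s be W' Hi Htr Hrep Hlen Hn
                 |i l s be W' b r l1 l2 Hi Htr Hrep Hlen Hf Hb Hn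
                 |be W' b r t' Hnz Hlen Hn]; cbn [fst]; rewrite length_app; simpl length;
    (split; [|lia]); try lia.
  pose proof (sval_bound r be). specialize (HX r).
  set (u := (Z.of_nat (x r) + sval r be)%Z) in *.
  assert (Hu : (sigma * sgn b * u <= 2 * Z.of_nat (X + N))%Z).
  { destruct Hsig as [-> | ->], b; cbn [sgn]; lia. }
  assert ((sigma * (Z.of_nat (3 * N + 2) * (W' + sgn b * u)) <=
    sigma * (Z.of_nat (3 * N + 2) * W') + Z.of_nat (3 * N + 2) * (2 * Z.of_nat (X + N)))%Z).
  { replace (sigma * (Z.of_nat (3 * N + 2) * (W' + sgn b * u)))%Z with
      (sigma * (Z.of_nat (3 * N + 2) * W') + Z.of_nat (3 * N + 2) * (sigma * sgn b * u))%Z by ring.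
    apply Z.add_le_mono_l, Z.mul_le_mono_nonneg_l; trivial. lia. }
  lia.
Qed.

Lemma play_growth P x N tr rf v sigma rho :
  inputs_ok x -> halting_trace P x N tr rf v ->
  (sigma = 1 \/ sigma = -1)%Z -> (1 <= sigma * (1 - 2 * Z.of_nat v))%Z ->
  is_play (game P x) rho ->
  (forall n l s r l1 l2, sigma = 1%Z ->
     snd (conf (game P x) rho n) = st_code (SA l) -> ticks (prefix rho n) <= N ->
     tr (ticks (prefix rho n)) = (l, s) ->
     fetch P l = IJz r l1 l2 -> e_dst (rho n) = st_code (ST (s r =? 0) l)) ->
  (forall n b l r l1 l2, sigma = (-1)%Z ->
     snd (conf (game P x) rho n) = st_code (ST b l) -> fetch P l = IJz r l1 l2 ->
     e_dst (rho n) =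
       if Bool.eqb b (Z.of_nat (x r) + sval r (fst (conf (game P x) rho n)) =? 0)%Z
       then st_code (SA (if b then l1 else l2)) else st_code (SC b r)) ->
  exists K D, 0 < K /\
    (forall n, Z.of_nat n <= sigma * (Z.of_nat K * wsum rho n) + Z.of_nat D)%Z /\
    stack_bounded (game P x) rho.
Proof.
  intros Hx Htr Hsig Hwin Hplay HA HT.
  assert (HI : forall n, inv P x N tr sigma n (conf (game P x) rho n) (wsum rho n)
    (ticks (prefix rho n))).
  { induction n as [|n IH].
    - destruct Htr as (H0 & _). cbn [wsum]. apply (invA P x N tr sigma 0 0 0 x []); try lia; trivial.
      split; [constructor|]. intros r. simpl. lia.
    - rewrite prefix_S, ticks_snoc. cbn [conf wsum].
      specialize (HA n). specialize (HT n). specialize (Hplay n).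
      destruct (conf (game P x) rho n) as [al q]. cbn [fst snd] in *.
      eapply inv_step; eauto. }
  exists (3 * N + 2), (2 * (3 * N + 2) * (x 0 + x 1 + x 2 + N) + 2 * N + 1).
  assert (HX : forall r, x r <= x 0 + x 1 + x 2).
  { intros [|[|[|r]]]; try lia. rewrite Hx; lia. }
  split; [lia|]. split.
  - intros n. eapply inv_bound; eauto.
  - exists (S N). intros n. eapply inv_bound; eauto.
Qed.

(** * From linear growth of the payoff to the objectives *)

Lemma avg_lower rho K D : 0 < K ->
  (forall n, Z.of_nat n <= Z.of_nat K * wsum rho n + Z.of_nat D)%Z ->
  forall i, 2 * D <= i -> 1 <= i -> (/ (2 * INR K) <= avg rho i)%R.
Proof.
  intros HK H i Hi H1. unfold avg. specialize (H i).
  assert (HKR : (0 < INR K)%R) by now apply lt_0_INR.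
  assert (HiR : (0 < INR i)%R) by (apply lt_0_INR; lia).
  (* For [2 * D <= i] the constant [D] is absorbed by half of [i]. *)
  assert (HR : (INR i <= 2 * INR K * IZR (wsum rho i))%R).
  { rewrite !INR_IZR_INZ, <- !mult_IZR. apply IZR_le. lia. }
  apply Rmult_le_reg_r with (INR i); trivial.
  unfold Rdiv. rewrite Rmult_assoc, Rinv_l, Rmult_1_r by lra.
  apply Rmult_le_reg_l with (2 * INR K)%R; [lra|].
  rewrite <- Rmult_assoc, Rinv_r, Rmult_1_l by lra. exact HR.
Qed.

Lemma objective_pos rho phi c K D : 0 < K ->
  (forall n, Z.of_nat n <= Z.of_nat K * wsum rho n + Z.of_nat D)%Z ->
  objective phi c rho.
Proof.
  intros HK H. pose proof (avg_lower rho K D HK H) as L.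
  assert (Hp : (0 < / (2 * INR K))%R)
    by (apply Rinv_0_lt_compat; apply lt_0_INR in HK; lra).
  destruct phi, c; simpl.
  - intros eps He n. exists (n + 2 * D + 1). repeat split; try lia.
    apply Rlt_le_trans with (/ (2 * INR K))%R; [lra|]. apply L; lia.
  - exists (/ (2 * INR K))%R. split; trivial. intros n. exists (n + 2 * D + 1).
    repeat split; try lia. apply L; lia.
  - intros eps He. exists (2 * D). intros i Hi H1.
    apply Rlt_le_trans with (/ (2 * INR K))%R; [lra|]. apply L; lia.
  - exists (/ (2 * INR K))%R. split; trivial. exists (2 * D). exact L.
Qed.

Lemma objective_neg rho phi c K D : 0 < K ->
  (forall n, Z.of_nat n <= - (Z.of_nat K * wsum rho n) + Z.of_nat D)%Z ->
  ~ objective phi c rho.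
Proof.
  intros HK H.
  (* Negating all weights reduces the upper bound on the averages to [avg_lower], which looks at
     weights only. *)
  pose (rho' := fun n => let e := rho n in
    mkEdge (e_src e) (e_top e) (e_dst e) (e_com e) (- e_w e)).
  assert (HW : forall n, wsum rho' n = (- wsum rho n)%Z).
  { induction n as [|n IH]; simpl; [reflexivity|]. rewrite IH. lia. }
  assert (L : forall i, 2 * D <= i -> 1 <= i -> (avg rho i <= - / (2 * INR K))%R).
  { intros i Hi H1.
    assert (L : (/ (2 * INR K) <= avg rho' i)%R).
    { apply avg_lower with D; trivial. intros n. rewrite HW. specialize (H n). lia. }
    unfold avg in L. rewrite HW, opp_IZR in L. unfold avg, Rdiv in *. lra. }
  assert (Hp : (0 < / (2 * INR K))%R)
    by (apply Rinv_0_lt_compat; apply lt_0_INR in HK; lra).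
  destruct phi, c; simpl.
  - intros Ho. destruct (Ho _ Hp (2 * D)) as (i & Hi & H1 & Ha). specialize (L i Hi H1). lra.
  - intros (eps & He & Ho). destruct (Ho (2 * D)) as (i & Hi & H1 & Ha).
    specialize (L i Hi H1). lra.
  - intros Ho. destruct (Ho _ Hp) as (n & Ha).
    specialize (Ha (n + 2 * D + 1) ltac:(lia) ltac:(lia)).
    specialize (L (n + 2 * D + 1) ltac:(lia) ltac:(lia)). lra.
  - intros (eps & He & n & Ha).
    specialize (Ha (n + 2 * D + 1) ltac:(lia) ltac:(lia)).
    specialize (L (n + 2 * D + 1) ltac:(lia) ltac:(lia)). lra.
Qed.

(** * Strategies *)

(** Claims are read off the trace at the time shown by the clock, not off the stack; a bounded clock
    is thus all the memory required. *)
Definition truthful_move (P : list instr) (tr : nat -> mconf) (t q g : nat) : edge :=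
  match st_decode q with
  | SA l =>
      match fetch P l with
      | IJz r l1 l2 => edge_of q g (ST (snd (tr t) r =? 0) l, Skip, 0%Z)
      | _ => edge_of q g (hd (SA 0, Skip, 0%Z) (out P (fun _ => 0) (SA l) g))
      end
  | _ => edge_of q g (SA 0, Skip, 0%Z)
  end.

Lemma truthful_move_enabled P x tr t al q : inputs_ok x ->
  q < 5 * gsize P -> Top al < 1 + 2 * gsize P -> is_A q = true ->
  enabled (game P x) (al, q) (truthful_move P tr t q (Top al)).
Proof.
  intros Hx Hq Hg HA. unfold is_A in HA. unfold truthful_move.
  destruct (st_decode q) as [l|b l|b l] eqn:E; try discriminate.
  cbn [out]. destruct (fetch P l) as [r|r|r l1 l2|r] eqn:Ef; apply game_enabled; trivial;
    rewrite E; cbn [out]; rewrite Ef; simpl; auto.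
  destruct (snd (tr t) r =? 0); auto.
Qed.

Lemma clamp_lt N t : Nat.min t N < S N.
Proof. lia. Qed.

Definition clamp (N t : nat) : Fin.t (S N) := Fin.of_nat_lt (clamp_lt N t).

Definition fin_val {N} (m : Fin.t N) : nat := proj1_sig (Fin.to_nat m).

Lemma fin_val_clamp N t : fin_val (clamp N t) = Nat.min t N.
Proof. unfold fin_val, clamp. now rewrite Fin.to_nat_of_nat. Qed.

Definition clamped_tick N (m : Fin.t (S N)) (e : edge) : Fin.t (S N) :=
  clamp N (tick (fin_val m) e).

(** Saturation at [N] commutes with every tick, be it an increment, a pause or a reset; up to [N],
    where the trace matters, the clock is exact. *)
Lemma clamped_ticks N h :
  fin_val (fold_left (clamped_tick N) h (clamp N 0)) = Nat.min (ticks h) N.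
Proof.
  induction h as [|e h IH] using rev_ind.
  - apply fin_val_clamp.
  - rewrite fold_left_app, ticks_snoc. cbn [fold_left]. unfold clamped_tick at 1.
    rewrite fin_val_clamp, IH. unfold tick. destruct (st_decode (e_src e)); lia.
Qed.

Lemma player1_wins_halting P x N tr rf phi c fm sb :
  inputs_ok x -> halting_trace P x N tr rf 0 -> player1_wins (game P x) phi c fm sb.
Proof.
  intros Hx Htr. set (G := game P x).
  pose (nxt := fun (m : Fin.t (S N)) q g => truthful_move P tr (fin_val m) q g).
  pose (s := fun h : list edge => nxt (fold_left (clamped_tick N) h (clamp N 0))
    (snd (run (init_config G) h)) (Top (fst (run (init_config G) h)))).
  assert (Hv : valid_wpg G) by now apply game_valid.
  exists s. split; [|split].
  (* Legality also concerns histories that deviate from the strategy; at a test both claims are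
     enabled, whatever the clock shows. *)
  - intros h Hl Hq. destruct (legal_bounds G h Hv Hl) as [B1 B2].
    apply in_Q1_game in Hq as [_ HA].
    apply Top_bound in B2; [|apply Hv].
    unfold s, nxt. destruct (run (init_config G) h) as [al q].
    now apply truthful_move_enabled.
  - destruct fm; trivial.
    exists (Fin.t (S N)), (FinFun.Fin_Finite (S N)), (clamp N 0), (clamped_tick N), nxt.
    reflexivity.
  - intros rho Hplay Hcons.
    destruct (play_growth P x N tr rf 0 1 rho) as (K & D & HK & Hg & Hsb); auto; try lia.
    + intros n l st r l1 l2 _ Hq Ht Htn Hf.
      assert (HQ : in_Q1 G (snd (conf G rho n))).
      { apply in_Q1_game. split.
        - destruct (Hplay n) as (He & Hs & _).
          fold G in Hs. rewrite <- Hs. apply Hv in He. apply He.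
        - unfold G. rewrite Hq. unfold is_A. now rewrite st_codeK. }
      rewrite (Hcons n HQ). unfold s, nxt.
      rewrite clamped_ticks, <- conf_run, Nat.min_l by trivial.
      unfold truthful_move. unfold G. rewrite Hq, st_codeK, Hf, Htn. reflexivity.
    + split; [|now destruct sb].
      apply objective_pos with K D; [exact HK|]. intros n. specialize (Hg n). lia.
Qed.

(** Player 2 may inspect the whole stack and so compares each claim with the value recorded
    there. *)
Definition spoiling_move (P : list instr) (x : store) (c : config) : edge :=
  let q := snd c in let g := Top (fst c) in
  let default := edge_of q g (hd (SA 0, Skip, 0%Z) (out P x (st_decode q) g)) in
  match st_decode q with
  | ST b l =>
      match fetch P l with
      | IJz r l1 l2 =>
          edge_of q g
            (if Bool.eqb b (Z.of_nat (x r) + sval r (fst c) =? 0)%Z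
             then (SA (if b then l1 else l2), Skip, 0%Z) else (SC b r, Skip, ent b))
      | _ => default
      end
  | _ => default
  end.

Lemma spoiling_move_enabled P x al q : inputs_ok x ->
  q < 5 * gsize P -> Top al < 1 + 2 * gsize P ->
  enabled (game P x) (al, q) (spoiling_move P x (al, q)).
Proof.
  intros Hx Hq Hg. unfold spoiling_move. cbn [fst snd].
  assert (Hd : enabled (game P x) (al, q)
    (edge_of q (Top al) (hd (SA 0, Skip, 0%Z) (out P x (st_decode q) (Top al))))).
  { apply game_enabled; trivial.
    destruct (out_nonempty P x (st_decode q) (Top al)) as [t Ht].
    destruct (out P x (st_decode q) (Top al)); [easy|]. now left. }
  destruct (st_decode q) as [l|b l|b l] eqn:E; trivial.
  destruct (fetch P l) as [r|r|r l1 l2|r] eqn:Ef; trivial.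
  apply game_enabled; trivial. rewrite E. cbn [out]. rewrite Ef.
  destruct (Bool.eqb b _); simpl; auto.
Qed.

(** Any strategy of player 1 is played against [spoiling_move]; the resulting play violates the
    mean-payoff condition, which is part of every variant. *)
Lemma player1_loses_halting P x N tr rf v phi c fm sb :
  inputs_ok x -> halting_trace P x N tr rf v -> 0 < v ->
  ~ player1_wins (game P x) phi c fm sb.
Proof.
  intros Hx Htr Hpos (s & Hs & _ & Hwin). set (G := game P x) in *.
  pose (choose := fun h => let c := run (init_config G) h in
    if nth (snd c) (player1 G) false then s h else spoiling_move P x c).
  (* Since the next move depends on the entire history, the histories are built first and the play
     is read off them. *)
  pose (hist := fix hist n := match n with 0 => [] | S n => hist n ++ [choose (hist n)] end).
  pose (rho := fun n => choose (hist n)).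
  assert (Hpre : forall n, prefix rho n = hist n).
  { induction n as [|n IH]; [reflexivity|]. rewrite prefix_S, IH. reflexivity. }
  assert (Hv : valid_wpg G) by now apply game_valid.
  assert (Hstep : forall h, legal_from G (init_config G) h ->
    enabled G (run (init_config G) h) (choose h)).
  { intros h Hl. unfold choose.
    destruct (nth (snd (run (init_config G) h)) (player1 G) false) eqn:E.
    - now apply Hs.
    - destruct (legal_bounds G h Hv Hl) as [B1 B2]. apply Top_bound in B2; [|apply Hv].
      destruct (run (init_config G) h) as [al q]. now apply spoiling_move_enabled. }
  assert (Hleg : forall n, legal_from G (init_config G) (hist n)).
  { induction n as [|n IH]; [exact I|]. apply legal_from_snoc. auto. }
  assert (Hplay : is_play G rho).
  { intros n. rewrite conf_run, Hpre. apply Hstep, Hleg. }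
  assert (Hcons : consistent G s rho).
  { intros n HQ. rewrite conf_run, Hpre in HQ. rewrite Hpre. unfold rho, choose.
    unfold in_Q1 in HQ. now rewrite HQ. }
  destruct (Hwin rho Hplay Hcons) as [Hobj _]. revert Hobj.
  destruct (play_growth P x N tr rf v (-1) rho) as (K & D & HK & Hg & _); auto; try lia.
  - intros n b l r l1 l2 _ Hq Hf.
    replace (rho n) with (spoiling_move P x (conf G rho n)).
    + unfold spoiling_move. unfold G. rewrite Hq, st_codeK, Hf.
      destruct (Bool.eqb b _); reflexivity.
    + unfold rho, choose. rewrite <- Hpre, <- conf_run.
      destruct (nth (snd (conf G rho n)) (player1 G) false) eqn:E; trivial.
      apply in_Q1_game in E as [_ E]. unfold G in E. rewrite Hq in E.
      unfold is_A in E. rewrite st_codeK in E. discriminate.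
  - apply objective_neg with K D; [exact HK|]. intros n. specialize (Hg n). lia.
Qed.

(** * Self-reference *)

(** The three zeros are the codes of the bottom symbol, the state [SA 0] and [Skip]. *)
Definition r_edge (q : nat) (w : rec) : rec :=
  r_pair (r_const q) (r_pair RZero (r_pair RZero (r_pair RZero w))).

Definition r_cons (e l : rec) : rec := RComp RSucc [r_pair e l].

(** [enc_Z] sends [2 v] to [4 v] and [- 2 v] to [4 v - 1]; the truncated predecessor is right for
    [v = 0] too. *)
Definition r_inputs (r : nat) (l : rec) : rec :=
  r_cons (r_edge (st_code (SC true r)) (RComp r_pred [r_mul4 (RProj r)]))
    (r_cons (r_edge (st_code (SC false r)) (r_mul4 (RProj r))) l).

(* On [gsize P; enc_list enc_edge (plain_edges P); enc_list enc_bool (owners P)],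
   this computes the code of the game of [P] started on these three numbers. *)
Definition r_game : rec :=
  r_pair (RComp r_add [r_mul4 (RProj 0); RProj 0])
    (r_pair (RComp RSucc [RComp r_add [RProj 0; RProj 0]])
      (r_pair RZero
        (r_pair (r_inputs 0 (r_inputs 1 (r_inputs 2 (RProj 1)))) (RProj 2)))).

Lemma eval_edge q w v z : eval w v (enc_Z z) ->
  eval (r_edge q w) v (enc_edge (mkEdge q 0 0 Skip z)).
Proof.
  intros H. apply eval_pair; [apply eval_const|].
  do 3 (apply eval_pair; [constructor|]). exact H.
Qed.

Lemma eval_inputs v r l es : eval l v (enc_list enc_edge es) ->
  eval (r_inputs r l) v (enc_list enc_edge
    (map (fun b => mkEdge (st_code (SC b r)) 0 0 Skip (sgn b * Z.of_nat (nth r v 0)))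
       [true; false] ++ es)).
Proof.
  intros H. cbn [map app enc_list].
  pose proof (eval_mul4 _ _ _ (eProj r v)) as H4.
  apply eval_succ, eval_pair; [apply eval_edge|apply eval_succ, eval_pair; trivial; apply eval_edge].
  - replace (enc_Z _) with (4 * nth r v 0 - 1).
    + eapply eval_comp1; [exact H4|apply eval_pred].
    + unfold enc_Z, sgn. destruct (Z.leb_spec 0 (-2 * Z.of_nat (nth r v 0))); lia.
  - replace (enc_Z _) with (4 * nth r v 0); trivial.
    unfold enc_Z, sgn. destruct (Z.leb_spec 0 (2 * Z.of_nat (nth r v 0))); lia.
Qed.

(** These numbers do not depend on the initial registers, so taking them as the initial contents is
    not circular. *)
Definition self_inputs (P : list instr) : list nat :=
  [gsize P; enc_list enc_edge (plain_edges P); enc_list enc_bool (owners P)].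

Definition self_game (P : list instr) : wpg := game P (fun r => nth r (self_inputs P) 0).

Lemma eval_r_game P : eval r_game (self_inputs P) (enc_wpg (self_game P)).
Proof.
  unfold enc_wpg, self_game, game. cbn [nQ nG q0 edges player1].
  assert (H0 : eval (RProj 0) (self_inputs P) (gsize P)) by exact (eProj 0 _).
  apply eval_pair; [|apply eval_pair; [|apply eval_pair; [constructor|apply eval_pair]]].
  - replace (5 * gsize P) with (4 * gsize P + gsize P) by lia.
    eapply eval_comp2; [apply eval_mul4, H0|exact H0|apply eval_add].
  - replace (1 + 2 * gsize P) with (S (gsize P + gsize P)) by lia.
    apply eval_succ. eapply eval_comp2; [exact H0|exact H0|apply eval_add].
  - unfold special_edges. cbn [flat_map]. rewrite <- !app_assoc.
    do 3 apply eval_inputs. exact (eProj 1 _).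
  - exact (eProj 2 _).
Qed.

(* For Phi in {LimSupAvg, LimInfAvg}, |><| in {>=, >}:
   fm = false / true : arbitrary / finite-memory winning strategies;
   sb = false : objective Phi |><| 0 (part (1));
   sb = true  : objective Phi |><| 0 together with stack boundedness (part (2)). *)
Theorem theorem4 :
  forall (phi : avg_kind) (c : cmp) (fm sb : bool),
    undecidable_set (win_problem phi c fm sb).
Proof.
  intros phi c fm sb [p Hp].
  (* [P] applies [p] to the code of its own game. The arity [3] is the length of [self_inputs], so
     the answer ends up in register [3]. *)
  set (P := program (RComp p [r_game]) 3).
  set (x := fun r => nth r (self_inputs P) 0).
  assert (Hx : inputs_ok x) by (intros r Hr; now apply nth_overflow).
  assert (Hrun : forall y, eval p [enc_wpg (self_game P)] y ->
    exists N tr, halting_trace P x N tr 3 y).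
  { intros y Hy.
    destruct (program_correct (RComp p [r_game]) (self_inputs P) y) as (l & s & Hr & Hf & Hs).
    - eapply eval_comp1; [apply eval_r_game|exact Hy].
    - apply mreach_trace in Hr as (N & tr & H0 & HN & Htr).
      exists N, tr. split; [exact H0|]. split; [exact Htr|]. rewrite HN. now split. }
  specialize (Hp (enc_wpg (self_game P))) as [Hyes Hno].
  (* If player 1 won, [p] would answer [1], and the game of a machine halting with positive output
     is lost. *)
  assert (Hlose : ~ win_problem phi c fm sb (enc_wpg (self_game P))).
  { intros Hw. destruct (Hrun 1 (Hyes Hw)) as (N & tr & Htr).
    destruct Hw as (G & E & _ & Hwin). apply enc_wpg_inj in E. subst G.
    revert Hwin. eapply player1_loses_halting; [exact Hx|exact Htr|lia]. }
  (* Hence [p] answers [0], which makes player 1 win after all. *)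
  destruct (Hrun 0 (Hno Hlose)) as (N & tr & Htr).
  apply Hlose. exists (self_game P). split; [reflexivity|]. split.
  - now apply game_valid.
  - eapply player1_wins_halting; [exact Hx|exact Htr].
Qed.
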